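(* Let $\Delta$ be a simplicial complex on $[n]$, fix $i\in[n]$, $q\geq 0$, and a multidegree $a=(c;b)$ with $c\in\mathbb{Z}$, $b\in\mathbb{Z}^{[n]\setminus\{i\}}$. Let $\sigma=\operatorname{supp}_-(b)\subseteq[n]\setminus\{i\}$. If $\operatorname{supp}_+(b)\ne\varnothing$ then $H^q_{\mathfrak p_i}(k[\Delta])_{(c;b)}=0$. If $\operatorname{supp}_+(b)=\varnothing$, then $$\dim_k H^q_{\mathfrak p_i}(k[\Delta])_{(c;b)}=\begin{cases}\dim_k\widetilde H^{\,q-|\sigma|-1}\big(\operatorname{lk}_{\operatorname{del}_\Delta(i)}(\sigma);k\big),& c=0,\ \sigma\in\operatorname{del}_\Delta(i),\\[2pt] \dim_k\widetilde H^{\,q-|\sigma|-1}\big(\operatorname{lk}_{\operatorname{lk}_\Delta(i)}(\sigma);k\big),& c\ge1,\ \sigma\in\operatorname{lk}_\Delta(i),\\[2pt] 0,&\text{otherwise.}\end{cases}$$ Moreover $\operatorname{lk}_{\operatorname{del}_\Delta(i)}(\sigma)=\operatorname{lk}_\Delta(\sigma)\cap\operatorname{del}_\Delta(i)$ and $\operatorname{lk}_{\operatorname{lk}_\Delta(i)}(\sigma)=\operatorname{lk}_\Delta(\sigma\cup\{i\})$.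
   Context: $k$ is a field, $[n]=\{1,\dots,n\}$, $S=k[x_1,\dots,x_n]$ with the $\mathbb{Z}^n$-grading $\deg x_j=\mathbf e_j$. A simplicial complex on $[n]$ is a family of subsets (faces) of $[n]$ closed under passing to subsets; by convention every singleton $\{j\}$ is a face of $\Delta$. $I_\Delta\subseteq S$ is generated by the monomials $\prod_{j\in\tau}x_j$ with $\tau\subseteq[n]$, $\tau\notin\Delta$, and $k[\Delta]=S/I_\Delta$. For a complex $\Gamma$ and a finite set $\sigma$, $\operatorname{lk}_\Gamma(\sigma)=\{\tau:\tau\cap\sigma=\varnothing,\ \tau\cup\sigma\in\Gamma\}$; for a vertex $i$, $\operatorname{lk}_\Gamma(i)=\operatorname{lk}_\Gamma(\{i\})$ and $\operatorname{del}_\Gamma(i)=\{\tau\in\Gamma:i\notin\tau\}$. The vertex prime is $\mathfrak p_i=(x_j:j\ne i)\subseteq S$, and $H^q_{\mathfrak p_i}$ is local cohomology with support in $\mathfrak p_i$, with its natural $\mathbb{Z}^n$-grading. A multidegree $a\in\mathbb{Z}^n$ is written $a=(c;b)$ with $c=a_i$, $b=(a_j)_{j\ne i}$; $\operatorname{supp}_+(b)=\{j:b_j>0\}$ and $\operatorname{supp}_-(b)=\{j:b_j<0\}$. $\widetilde H^\bullet(-;k)$ is reduced simplicial cohomology, with $\widetilde H^{-1}(\{\varnothing\};k)=k$, all reduced cohomology of the void complex (no faces at all) zero, and zero in degrees $<-1$. *)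

(* Defs.v *)
From HB Require Import structures.
From mathcomp Require Import all_boot all_order all_algebra.
From mathcomp Require Import boolp.
From mathcomp Require Import mpoly.

Set Implicit Arguments.
Unset Strict Implicit.
Unset Printing Implicit Defensive.

Import Order.TTheory GRing.Theory Num.Theory.
Local Open Scope ring_scope.

(** ** Simplicial complexes on the vertex set 'I_n *)

Section Complexes.
Variable n : nat.
Implicit Types (G : {set {set 'I_n}}) (s t : {set 'I_n}) (i : 'I_n).

Definition down_closed G := forall s t, t \subset s -> s \in G -> t \in G.

Definition simplicial_complex G := down_closed G /\ forall j, [set j] \in G.

Definition link G s : {set {set 'I_n}} :=
  [set t : {set 'I_n} | [disjoint t & s] && (t :|: s \in G)].

Definition deletion G i : {set {set 'I_n}} := [set t : {set 'I_n} in G | i \notin t].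

End Complexes.

(** ** Reduced simplicial cohomology

  Faces are indexed by their cardinality s, i.e. by dimension s - 1; the empty
  face (if present) spans the cochains of cardinality 0.  Vertices are ordered
  by the order of 'I_n. *)

Section ReducedCohomology.
Variables (n : nat) (k : fieldType) (G : {set {set 'I_n}}).

Definition face (s : nat) := {t : {set 'I_n} | (t \in G) && (#|t| == s)}.

Definition cochain (s : nat) := {ffun face s -> k^o}.

Definition coboundary (s : nat) (f : cochain s) : cochain s.+1 :=
  [ffun t : face s.+1 => \sum_(v in val t) (-1) ^+ #|[set w : 'I_n in val t | (w < v)%N]| *
               \sum_(r : face s | val r == val t :\ v) f r].

Fact coboundary_is_linear s : linear (@coboundary s).
Proof.
move=> c f g; apply/ffunP => t; rewrite !ffunE scaler_sumr -big_split.
apply: eq_bigr => v _; rewrite /= scalerAr -mulrDr scaler_sumr -big_split.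
by congr (_ * _); apply: eq_bigr => r _; rewrite !ffunE.
Qed.

HB.instance Definition _ s := GRing.isLinear.Build k (cochain s) (cochain s.+1)
  *:%R (@coboundary s) (@coboundary_is_linear s).

Definition cocycles s : {vspace cochain s} := lker (linfun (@coboundary s)).

Definition coboundaries s : {vspace cochain s} :=
  match s with
  | 0%N => 0%VS
  | s'.+1 => limg (linfun (@coboundary s'))
  end.

(* Coboundaries are cocycles, so the truncated subtraction is the dimension of
   the quotient.  Degrees p < -1, where p + 1 < 0, give 0. *)
Definition redcoh_dim (p : int) : nat :=
  if (p + 1)%R is Posz s then (\dim (cocycles s) - \dim (coboundaries s))%N
  else 0%N.

End ReducedCohomology.

(** ** Z^n-graded modules over S = k[x_1, ..., x_n] *)

Notation degree n := {ffun 'I_n -> int}.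

Definition dle n (a b : degree n) : bool := [forall j, a j <= b j].

(* A Z^n-graded S-module is given by its homogeneous components together with
   the k-linear maps [gmul ab : M_a -> M_b], for a <= b, which are the
   multiplications by the monomial x^(b - a); multiplication by x_j is the
   case b = a + e_j. *)
Record gmod (k : fieldType) (n : nat) := GMod {
  gcomp :> degree n -> lmodType k;
  gmul : forall a b, dle a b -> {linear gcomp a -> gcomp b};
  gmul_id : forall a (aa : dle a a) x, gmul aa x = x;
  gmul_comp : forall a b c (ab : dle a b) (bc : dle b c) (ac : dle a c) x,
    gmul bc (gmul ab x) = gmul ac x
}.

Record ghom (k : fieldType) (n : nat) (M N : gmod k n) := GHom {
  gfun :> forall a, {linear M a -> N a};
  gfun_mul : forall a b (ab : dle a b) x,
    gfun b (gmul M ab x) = gmul N ab (gfun a x)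
}.

Record gsub (k : fieldType) (n : nat) (M : gmod k n) := GSub {
  gsubp : forall a, submodClosed (M a);
  gsub_mul : forall a b (ab : dle a b) x,
    x \in gsubp a -> gmul M ab x \in gsubp b
}.

(** *** Quotients *)

Section QuotientSpace.
Variables (k : fieldType) (V : lmodType k) (W : submodClosed V).

Definition quot_pred : {pred V} := fun x => x \in W.

HB.instance Definition _ := GRing.isZmodClosed.Build V quot_pred
  (GRing.submod_closedB (submodClosedP W)).

Definition quot_space := Quotient.quot quot_pred.
HB.instance Definition _ := GRing.Zmodule.on quot_space.

Definition quot_proj (x : V) : quot_space := (\pi_(Quotient.quot quot_pred) x)%qT.

Definition quot_repr (x : quot_space) : V := repr (x : Quotient.quot quot_pred).

Lemma quot_reprK x : quot_proj (quot_repr x) = x.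
Proof. exact: reprK. Qed.

Lemma quot_projP x y : reflect (quot_proj x = quot_proj y) (x - y \in W).
Proof.
rewrite -[_ \in W]/(x - y \in quot_pred) Quotient.idealrBE; exact: eqP.
Qed.

Lemma quot_reprP x : quot_repr (quot_proj x) - x \in W.
Proof. by apply/quot_projP; rewrite quot_reprK. Qed.

Lemma quot_projD x y : quot_proj (x + y) = quot_proj x + quot_proj y.
Proof. by rewrite /quot_proj raddfD. Qed.

Definition quot_scale (c : k) (x : quot_space) := quot_proj (c *: quot_repr x).

Lemma quot_projZ c x : quot_proj (c *: x) = quot_scale c (quot_proj x).
Proof.
apply/esym/quot_projP.
by rewrite -scalerBr rpredZ // quot_reprP.
Qed.

Fact quot_scaleA c d x : quot_scale c (quot_scale d x) = quot_scale (c * d) x.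
Proof. by rewrite -[x]quot_reprK -!quot_projZ scalerA. Qed.
Fact quot_scale1 : left_id 1 quot_scale.
Proof. by move=> x; rewrite -[x]quot_reprK -!quot_projZ scale1r. Qed.
Fact quot_scaleDr : right_distributive quot_scale +%R.
Proof.
move=> c x y; rewrite -[x]quot_reprK -[y]quot_reprK.
by rewrite -quot_projD -!quot_projZ scalerDr quot_projD.
Qed.
Fact quot_scaleDl x : {morph quot_scale^~ x : c d / c + d}.
Proof.
move=> c d; rewrite -[x]quot_reprK.
by rewrite -!quot_projZ scalerDl quot_projD.
Qed.

HB.instance Definition _ := GRing.Zmodule_isLmodule.Build k quot_space
  quot_scaleA quot_scale1 quot_scaleDr quot_scaleDl.

Fact quot_proj_is_linear : linear quot_proj.
Proof. by move=> c x y; rewrite quot_projD quot_projZ. Qed.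

HB.instance Definition _ :=
  GRing.isLinear.Build k V quot_space *:%R quot_proj quot_proj_is_linear.

End QuotientSpace.

Section QuotientModule.
Variables (k : fieldType) (n : nat) (M : gmod k n) (N : gsub M).

Definition gquot_comp (a : degree n) : lmodType k := quot_space (gsubp N a).

Definition gquot_mul a b (ab : dle a b) (x : gquot_comp a) : gquot_comp b :=
  quot_proj (gsubp N b) (gmul M ab (quot_repr x)).

Lemma gquot_mul_proj a b (ab : dle a b) x :
  gquot_mul ab (quot_proj (gsubp N a) x) = quot_proj (gsubp N b) (gmul M ab x).
Proof. by apply/quot_projP; rewrite -raddfB gsub_mul ?quot_reprP. Qed.

Fact gquot_mul_is_linear a b (ab : dle a b) : linear (gquot_mul ab).
Proof.
move=> c x y; rewrite -[x]quot_reprK -[y]quot_reprK.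
by rewrite -linearP !gquot_mul_proj !linearP.
Qed.

HB.instance Definition _ a b (ab : dle a b) :=
  GRing.isLinear.Build k (gquot_comp a) (gquot_comp b) *:%R (gquot_mul ab)
    (gquot_mul_is_linear ab).

Fact gquot_mul_id a (aa : dle a a) x : gquot_mul aa x = x.
Proof. by rewrite -[x]quot_reprK gquot_mul_proj gmul_id. Qed.

Fact gquot_mul_comp a b c (ab : dle a b) (bc : dle b c) (ac : dle a c) x :
  gquot_mul bc (gquot_mul ab x) = gquot_mul ac x.
Proof. by rewrite -[x]quot_reprK !gquot_mul_proj (gmul_comp _ _ ac). Qed.

Definition gquot : gmod k n :=
  @GMod k n gquot_comp (fun a b ab => gquot_mul ab : {linear _ -> _})
    gquot_mul_id gquot_mul_comp.

End QuotientModule.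

(** *** The polynomial ring as a graded module *)

Section PolynomialRing.
Variables (k : fieldType) (n : nat).
Implicit Types (a b : degree n).

Definition has_degree a : {pred {mpoly k[n]}} :=
  fun p => all (fun m : 'X_{1..n} => [forall j, (m j)%:Z == a j]) (msupp p).

Fact has_degree_submod a : submod_closed (has_degree a).
Proof.
split=> [|c p q /allP hp /allP hq]; first by rewrite unfold_in msupp0.
apply/allP => m /msuppD_le; rewrite mem_cat => /orP[/msuppZ_le /hp //|/hq //].
Qed.

HB.instance Definition _ a :=
  GRing.isSubmodClosed.Build k {mpoly k[n]} (has_degree a)
    (GRing.submod_closed_semi (has_degree_submod a)).

Record gpoly a := GPoly { gpoly_val :> {mpoly k[n]}; _ : gpoly_val \in has_degree a }.

HB.instance Definition _ a := [isSub for @gpoly_val a].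
HB.instance Definition _ a := [Choice of gpoly a by <:].
HB.instance Definition _ a :=
  [SubChoice_isSubLmodule of gpoly a by <:].

Definition mdiff a b : 'X_{1..n} := [multinom `|b j - a j|%N | j < n].

Fact gpoly_mul_subproof a b (ab : dle a b) (p : gpoly a) :
  'X_[mdiff a b] * val p \in has_degree b.
Proof.
apply/allP => m; rewrite mulrC (perm_mem (msuppMX _ _)) => /mapP[m' hm' ->].
apply/forallP => j; have /allP/(_ m' hm')/forallP/(_ j)/eqP hj := valP p.
rewrite mnmDE mnmE PoszD hj gez0_abs ?subr_ge0 ?(forallP ab) //.
by rewrite subrK.
Qed.

Definition gpoly_mul a b (ab : dle a b) (p : gpoly a) : gpoly b :=
  GPoly (gpoly_mul_subproof ab p).

Fact gpoly_mul_is_linear a b (ab : dle a b) : linear (gpoly_mul ab).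
Proof.
move=> c p q; apply: val_inj; rewrite /= mulrDr -scalerAr; reflexivity.
Qed.

HB.instance Definition _ a b (ab : dle a b) :=
  GRing.isLinear.Build k (gpoly a) (gpoly b) *:%R (gpoly_mul ab)
    (gpoly_mul_is_linear ab).

Fact gpoly_mul_id a (aa : dle a a) p : gpoly_mul aa p = p.
Proof.
apply: val_inj => /=; suff -> : mdiff a a = 0%MM by rewrite mpolyX0 mul1r.
by apply/mnmP => j; rewrite mnmE subrr mnm0E.
Qed.

Fact gpoly_mul_comp a b c (ab : dle a b) (bc : dle b c) (ac : dle a c) p :
  gpoly_mul bc (gpoly_mul ab p) = gpoly_mul ac p.
Proof.
apply: val_inj; rewrite /= mulrA -mpolyXD; congr ('X_[_] * _).
apply/mnmP => j; rewrite mnmDE !mnmE; apply/eqP.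
rewrite -eqz_nat PoszD !gez0_abs ?subr_ge0 ?(forallP ab) ?(forallP bc) ?(forallP ac) //.
by rewrite addrA subrK.
Qed.

Definition gpolyring : gmod k n :=
  @GMod k n gpoly (fun a b ab => gpoly_mul ab : {linear _ -> _})
    gpoly_mul_id gpoly_mul_comp.

End PolynomialRing.

(** *** Ideals of S *)

Section Ideals.
Variables (k : fieldType) (n : nat).
Local Notation S := {mpoly k[n]}.

Definition ideal_gen (X : S -> Prop) (f : S) : Prop :=
  exists2 s : seq (S * S), (forall u, u \in s -> X u.2) &
    f = \sum_(u <- s) u.1 * u.2.

Fixpoint ideal_pow (I : S -> Prop) (t : nat) : S -> Prop :=
  if t is t'.+1 then
    ideal_gen (fun h => exists f g, [/\ ideal_pow I t' f, I g & h = f * g])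
  else fun=> True.

Definition nonface_monomial (D : {set {set 'I_n}}) (f : S) : Prop :=
  exists2 t : {set 'I_n}, t \notin D & f = \prod_(j in t) 'X_j.

Definition vertex_prime (i : 'I_n) : S -> Prop :=
  ideal_gen (fun f => exists2 j : 'I_n, j != i & f = 'X_j).

Lemma ideal_gen0 X : ideal_gen X 0.
Proof. by exists [::] => //; rewrite big_nil. Qed.

Lemma ideal_genD X f g : ideal_gen X f -> ideal_gen X g -> ideal_gen X (f + g).
Proof.
case=> s sX -> [t tX ->]; exists (s ++ t); last by rewrite big_cat.
by move=> u; rewrite mem_cat => /orP[/sX|/tX].
Qed.

Lemma ideal_genM X f g : ideal_gen X g -> ideal_gen X (f * g).
Proof.
case=> s sX ->; exists [seq (f * u.1, u.2) | u <- s].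
  by move=> v /mapP[u us ->]; exact: sX us.
by rewrite big_map mulr_sumr; apply: eq_bigr => u _; rewrite mulrA.
Qed.

Definition gideal_pred (X : S -> Prop) (a : degree n) : {pred gpoly k a} :=
  fun p => `[< ideal_gen X (val p) >].

Fact gideal_pred_submod X a : submod_closed (@gideal_pred X a).
Proof.
split=> [|c p q /asboolP hp /asboolP hq]; apply/asboolP; first exact: ideal_gen0.
apply: ideal_genD hq; rewrite /= -mul_mpolyC; exact: ideal_genM.
Qed.

HB.instance Definition _ X a :=
  GRing.isSubmodClosed.Build k (gpoly k a) (@gideal_pred X a)
    (GRing.submod_closed_semi (gideal_pred_submod X a)).

Fact gideal_mul X a b (ab : dle a b) (p : gpolyring k n a) :
  p \in @gideal_pred X a -> gmul (gpolyring k n) ab p \in @gideal_pred X b.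
Proof. by move=> /asboolP hp; apply/asboolP; apply: ideal_genM. Qed.

(* The homogeneous components of the ideal generated by X (which is the whole
   ideal when X consists of homogeneous elements). *)
Definition gideal (X : S -> Prop) : gsub (gpolyring k n) :=
  @GSub k n (gpolyring k n) (fun a => @gideal_pred X a : submodClosed _)
    (@gideal_mul X).

End Ideals.

Definition stanley_reisner_ring (k : fieldType) (n : nat)
    (D : {set {set 'I_n}}) : gmod k n :=
  gquot (gideal (@nonface_monomial k n D)).

(** ** Local cohomology

  The right derived functors of the I-torsion functor on the category of
  Z^n-graded S-modules: H^q_I(M)_a is the degree a component of the q-th
  cohomology of the I-torsion of an injective resolution E of M.  This category
  has enough injectives, and the result does not depend on E. *)

Definition ginjective (k : fieldType) (n : nat) (E : gmod k n) : Prop :=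
  forall (A B : gmod k n) (u : ghom A B) (f : ghom A E),
    (forall a, injective (u a)) ->
    exists g : ghom B E, forall a x, g a (u a x) = f a x.

Record ginjres (k : fieldType) (n : nat) (M : gmod k n) := GInjRes {
  gres :> nat -> gmod k n;
  gres_aug : ghom M (gres 0);
  gres_d : forall q, ghom (gres q) (gres q.+1);
  gres_injective : forall q, ginjective (gres q);
  gres_aug_inj : forall a, injective (gres_aug a);
  gres_exact0 : forall a x,
    gres_d 0 a x = 0 <-> exists y, x = gres_aug a y;
  gres_exactS : forall q a x,
    gres_d q.+1 a x = 0 <-> exists y, x = gres_d q a y
}.

Section LocalCohomology.
Variables (k : fieldType) (n : nat) (I : {mpoly k[n]} -> Prop).

(* Membership in the degree a component of {x in M | I^t x = 0 for some t},
   for an ideal I generated by monomials: I^t is then spanned by the monomials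
   it contains, and those are the only elements that need to be tested. *)
Definition gtorsion (M : gmod k n) (a : degree n) (x : M a) : Prop :=
  exists t, forall b (ab : dle a b),
    ideal_pow I t 'X_[mdiff a b] -> gmul M ab x = 0.

Variables (M : gmod k n) (E : ginjres M).

Definition lc_cocycle q (a : degree n) (x : E q a) : Prop :=
  gtorsion x /\ gres_d E q a x = 0.

Definition lc_coboundary q (a : degree n) : E q a -> Prop :=
  match q with
  | 0%N => fun x => x = 0
  | q'.+1 => fun x => exists2 y, gtorsion y & x = gres_d E q' a y
  end.

(* H^q_I(M)_a = 0. *)
Definition lc_vanishes q (a : degree n) : Prop :=
  forall x, @lc_cocycle q a x -> @lc_coboundary q a x.

(* H^q_I(M)_a has a basis with d elements, the classes of the e r. *)
Definition lc_has_dim q (a : degree n) (d : nat) : Prop :=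
  exists e : 'I_d -> E q a,
    [/\ forall r, lc_cocycle (e r),
        forall x, lc_cocycle x ->
          exists c : 'I_d -> k, lc_coboundary (x - \sum_r c r *: e r)
      & forall c : 'I_d -> k,
          lc_coboundary (\sum_r c r *: e r) -> forall r, c r = 0].

End LocalCohomology.

(** ** Supports *)

(* For a multidegree a = (c; b) with c = a i and b = (a j), j != i. *)
Definition supp_pos n (i : 'I_n) (a : degree n) : {set 'I_n} :=
  [set j | (j != i) && (0 < a j)].

Definition supp_neg n (i : 'I_n) (a : degree n) : {set 'I_n} :=
  [set j | (j != i) && (a j < 0)].

(* Main.v *)
(** For j <> i, the Koszul complexes of the x_j^r on an injective module are exact
    in positive degrees, with cohomology in degree 0 the elements killed by all
    x_j^r. In the double complex of the Koszul complexes of an injective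
    resolution of k[D], local cohomology is therefore the limit in r of the
    Koszul cohomology of k[D]. In degree a + r e_t, for t a set of vertices other
    than i and r large, k[D] is k or 0 independently of r, which turns the
    Koszul complex in degree a into the complex of functions on a family of sets
    t: a cone when supp_+(b) is nonempty, and otherwise, up to signs, the
    cochains of a link, shifted by |sigma|. *)

From HB Require Import structures.
From mathcomp Require Import boolp.
From mathcomp Require Import mpoly.
Require Import Defs.
From mathcomp Require Import all_boot all_order all_algebra.

Set Implicit Arguments.
Unset Strict Implicit.
Unset Printing Implicit Defensive.

Import Order.TTheory GRing.Theory Num.Theory.
Local Open Scope ring_scope.

(** * Signed incidence sums on subsets of 'I_n *)

(** Exactness on injectives needs no structure theory: an injective module is a retract of its
    cofree hull, and on the factor of index c of the hull the Koszul complex is a cone as soon as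
    [a j + r <= c j] for some [j != i], and otherwise lives in degree 0 only. The cohomology of the
    resolution is not known beforehand to be finite dimensional, and a staircase in the double
    complex involves choices. Classes are therefore compared by a relation between individual
    elements, shown in both directions to respect cocycles and coboundaries; dimensions enter only
    at the end, by lifting a basis. The limit reduces to the choice of one exponent: once r exceeds
    all |a_j|, the transition maps are the identity in coordinates, so r can be enlarged to kill any
    given torsion element. The three cases for c come from the sets t avoiding i: a negative c can
    never be compensated, c = 0 leaves the faces without i, and c >= 1 adds i to every face. *)

Section Incidence.
Variables (k : fieldType) (n : nat).
Implicit Types (v w : 'I_n) (s t : {set 'I_n}).

Definition incidence v t : k := (-1) ^+ #|[set w : 'I_n in t | (w < v)%N]|.

Lemma incidenceK v t : incidence v t * incidence v t = 1.
Proof. by rewrite -expr2 sqrr_sign. Qed.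

(** For [v < w], removing [v] lowers by one the number of elements below [w], while removing [w]
    leaves the number below [v] unchanged. *)
Lemma incidence_swap v w t : v != w -> v \in t -> w \in t ->
  incidence v t * incidence w (t :\ v) =
  - (incidence w t * incidence v (t :\ w)).
Proof.
wlog vw : v w / (v < w)%N => [hw|] vw' vt wt.
  case: (ltngtP v w) => [/hw->//|/hw->//|/val_inj vw].
  - by rewrite opprK.
  - by rewrite eq_sym.
  by rewrite vw eqxx in vw'.
have -> : incidence w t = - incidence w (t :\ v).
  rewrite /incidence (cardsD1 v) inE vt vw /= exprS mulN1r.
  congr (- (-1) ^+ _); apply: eq_card => u; rewrite !inE.
  by case: (u != v).
have -> : incidence v (t :\ w) = incidence v t.
  congr ((-1) ^+ _); apply: eq_card => u; rewrite !inE.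
  by case: eqVneq => // ->; rewrite ltnNge ltnW //= andbF.
by rewrite mulNr opprK mulrC.
Qed.

Variable V : lmodType k.
Implicit Types f g : {set 'I_n} -> V.

(** The signs are those of [coboundary], but on functions of all subsets with values in any module,
    so that Koszul differentials and simplicial cochains share one operator. *)
Definition cobound f t : V := \sum_(v in t) incidence v t *: f (t :\ v).

Lemma eq_cobound f g t : (forall v, v \in t -> f (t :\ v) = g (t :\ v)) ->
  cobound f t = cobound g t.
Proof. by move=> fg; apply: eq_bigr => v vt; rewrite fg. Qed.

Lemma coboundD f g t : cobound (fun s => f s + g s) t = cobound f t + cobound g t.
Proof. by rewrite -big_split; apply: eq_bigr => v _; rewrite scalerDr. Qed.

Lemma coboundZ c f t : cobound (fun s => c *: f s) t = c *: cobound f t.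
Proof.
by rewrite scaler_sumr; apply: eq_bigr => v _; rewrite !scalerA mulrC.
Qed.

Lemma coboundB f g t : cobound (fun s => f s - g s) t = cobound f t - cobound g t.
Proof.
by rewrite -sumrB; apply: eq_bigr => v _; rewrite scalerBr.
Qed.

Lemma cobound0 t : cobound (fun=> 0) t = 0.
Proof. by rewrite /cobound big1 // => v _; rewrite scaler0. Qed.

Lemma cobound_set1 f v : cobound f [set v] = f set0.
Proof.
rewrite /cobound big_set1 setDv /incidence.
rewrite (_ : [set _ in _ | _] = set0) ?cards0 ?scale1r //.
by apply/setP => w; rewrite !inE; case: eqVneq => // ->; rewrite ltnn.
Qed.

(** The terms of (v, w) and (w, v) cancel by [incidence_swap]; the inner sums are split by the order
    of v and w to pair them. *)
Lemma cobound_cobound f t : cobound (cobound f) t = 0.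
Proof.
pose F v w := incidence v t *: (incidence w (t :\ v) *: f (t :\ v :\ w)).
have FN v w : v \in t -> w \in t -> v != w -> F v w = - F w v.
  move=> vt wt vw; rewrite /F !scalerA incidence_swap // scaleNr.
  by rewrite setDDl setUC -setDDl.
rewrite /cobound.
under eq_bigr => v vt.
  rewrite scaler_sumr (bigID (fun w : 'I_n => (v < w)%N)) /=.
  rewrite (eq_bigl (fun w => (w \in t) && (v < w)%N)); last first.
    by move=> w; rewrite !inE; case: eqVneq => //= ->; rewrite ltnn andbF.
  rewrite [X in _ + X](eq_bigl (fun w => (w \in t) && (w < v)%N)); last first.
    move=> w; rewrite !inE -leqNgt; case: eqVneq => /= [->|wv].
      by rewrite ltnn andbF.
    by rewrite ltn_neqAle (inj_eq val_inj) wv.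
  over.
rewrite big_split /= [X in _ + X](exchange_big_dep (mem t)) /=; last first.
  by move=> v w _ /andP[].
rewrite -big_split big1 // => v vt /=.
rewrite -[X in _ + X]opprK -sumrN; apply/eqP; rewrite subr_eq0; apply/eqP.
rewrite [RHS](eq_bigl (fun w => (w \in t) && (v < w)%N)); last first.
  by move=> w; rewrite vt.
apply: eq_bigr => w /andP[wt vw]; rewrite -/(F v w) -/(F w v) FN //.
by apply: contraTneq vw => ->; rewrite ltnn.
Qed.

(* Removing v contracts the cochains of any cone with apex v. *)
Definition cone_contraction v f t : V :=
  if v \in t then 0 else incidence v (v |: t) *: f (v |: t).

(** The cone homotopy at a single set: the cocycle equation enters only at [v |: t], where it
    expresses [f t] through the other terms. This local form applies to functions that are cocycles
    on some sets only. *)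
Lemma cone_contractionP v f t : (v \notin t -> cobound f (v |: t) = 0) ->
  f t = cobound (cone_contraction v f) t.
Proof.
have [vt _|vt /(_ isT)] := boolP (v \in t).
  rewrite /cobound (bigD1 v) //= big1 ?addr0 => [|w /andP[wt wv]].
    by rewrite /cone_contraction !inE eqxx /= setD1K // scalerA incidenceK scale1r.
  by rewrite /cone_contraction !inE eq_sym wv vt scaler0.
rewrite /cobound big_setU1 //= setU1K // => /(congr1 (GRing.scale (incidence v (v |: t)))).
rewrite scaler0 scalerDr scalerA incidenceK scale1r => /eqP.
rewrite addr_eq0 => /eqP ->; rewrite scaler_sumr -sumrN.
apply: eq_bigr => w wt; rewrite /cone_contraction !inE (negPf vt) andbF.
have wv : v != w by apply: contraNneq vt => ->.
have Dw : (v |: t) :\ w = v |: (t :\ w).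
  by apply/setP => u; rewrite !inE; case: (eqVneq u v) => //= ->; rewrite wv.
rewrite !scalerA -scaleNr Dw; congr (_ *: _).
have /(congr1 (fun c => incidence v (v |: t) * c)) := incidence_swap wv (setU11 v t) (setU1r v wt).
rewrite setU1K // Dw mulrA incidenceK mul1r => ->.
by rewrite mulrN mulNr mulrA -[_ * _ * incidence v (v |: t :\ w) * _]mulrA incidenceK mulr1.
Qed.

End Incidence.

(** * Graded modules *)

Section DegreeOrder.
Variable n : nat.
Implicit Types b c d : degree n.

Lemma dle_refl b : dle b b.
Proof. by apply/forallP => j. Qed.

Lemma dle_trans b c d : dle b c -> dle c d -> dle b d.
Proof. by move=> /forallP bc /forallP cd; apply/forallP => j; apply: le_trans (cd j). Qed.

End DegreeOrder.

Section Shift.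
Variables (k : fieldType) (n : nat).
Implicit Types (M N : gmod k n) (b c d : degree n).

(** A total version of [gmul], with value 0 when [c] is not above [b], so that sums and families
    carry no order proofs. *)
Definition gshift M b c (x : M b) : M c :=
  if decP (@idP (dle b c)) is left bc then gmul M bc x else 0.
Arguments gshift {M b} c x.

Fact gshift_is_linear M b c : linear (@gshift M b c).
Proof.
rewrite /gshift => l x y; case: (decP (@idP (dle b c))) => bc; first exact: linearP.
by rewrite scaler0 addr0.
Qed.

HB.instance Definition _ M b c :=
  GRing.isLinear.Build k (M b) (M c) *:%R (@gshift M b c) (@gshift_is_linear M b c).

Lemma gshiftE M b c (bc : dle b c) (x : M b) : gshift c x = gmul M bc x.
Proof.
rewrite /gshift; case: (decP (@idP (dle b c))) => [bc'|/(_ bc)//].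
by rewrite (bool_irrelevance bc bc').
Qed.

Lemma gshift_id M b (x : M b) : gshift b x = x.
Proof. by rewrite (gshiftE (dle_refl b)) gmul_id. Qed.

Lemma gshift_comp M b c d (x : M b) : dle b c -> dle c d ->
  gshift d (gshift c x) = gshift d x.
Proof.
move=> bc cd; rewrite (gshiftE bc) (gshiftE cd) (gshiftE (dle_trans bc cd)).
exact: gmul_comp.
Qed.

Lemma gfun_shift M N (u : ghom M N) b c (x : M b) :
  u c (gshift c x) = gshift c (u b x).
Proof.
rewrite /gshift; case: (decP (@idP (dle b c))) => bc; last exact: linear0.
exact: gfun_mul.
Qed.

End Shift.
Arguments gshift {k n M b} c x.

(** * Products of modules over arbitrary index types *)

Section ProductModule.
Variables (k : fieldType) (I : Type) (V : I -> lmodType k).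

(** The degrees above a given one are infinite in number and the factors vary with the index, hence
    dependent functions with classical equality and choice. *)
Definition prod_module := forall j, V j.

HB.instance Definition _ := gen_eqMixin prod_module.
HB.instance Definition _ := gen_choiceMixin prod_module.

Implicit Types x y z : prod_module.

Definition prod_module0 : prod_module := fun=> 0.
Definition prod_moduleN x : prod_module := fun j => - x j.
Definition prod_moduleD x y : prod_module := fun j => x j + y j.
Definition prod_moduleZ c x : prod_module := fun j => c *: x j.

Fact prod_moduleDA : associative prod_moduleD.
Proof. by move=> x y z; apply: functional_extensionality_dep => j; exact: addrA. Qed.
Fact prod_moduleDC : commutative prod_moduleD.
Proof. by move=> x y; apply: functional_extensionality_dep => j; exact: addrC. Qed.
Fact prod_module0D : left_id prod_module0 prod_moduleD.
Proof. by move=> x; apply: functional_extensionality_dep => j; exact: add0r. Qed.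
Fact prod_moduleND : left_inverse prod_module0 prod_moduleN prod_moduleD.
Proof. by move=> x; apply: functional_extensionality_dep => j; exact: addNr. Qed.

HB.instance Definition _ := GRing.isZmodule.Build prod_module
  prod_moduleDA prod_moduleDC prod_module0D prod_moduleND.

Fact prod_moduleZA c d x :
  prod_moduleZ c (prod_moduleZ d x) = prod_moduleZ (c * d) x.
Proof. by apply: functional_extensionality_dep => j; exact: scalerA. Qed.
Fact prod_module1Z : left_id 1 prod_moduleZ.
Proof. by move=> x; apply: functional_extensionality_dep => j; exact: scale1r. Qed.
Fact prod_moduleZDr : right_distributive prod_moduleZ +%R.
Proof. by move=> c x y; apply: functional_extensionality_dep => j; exact: scalerDr. Qed.
Fact prod_moduleZDl x : {morph prod_moduleZ^~ x : c d / c + d}.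
Proof. by move=> c d; apply: functional_extensionality_dep => j; exact: scalerDl. Qed.

HB.instance Definition _ := GRing.Zmodule_isLmodule.Build k prod_module
  prod_moduleZA prod_module1Z prod_moduleZDr prod_moduleZDl.

Lemma prod_module_sumE (J : Type) (r : seq J) (P : pred J) (F : J -> prod_module) j :
  (\sum_(u <- r | P u) F u) j = \sum_(u <- r | P u) F u j.
Proof. by elim/big_rec2: _ => // u y z _ <-. Qed.

End ProductModule.

(* Every graded module embeds in the product over c of the cofree modules which
   are M_c in all degrees b <= c, by x |-> (x^(c - b) x)_c. *)
Section CofreeHull.
Variables (k : fieldType) (n : nat) (M : gmod k n).

Definition hull_comp (b : degree n) : lmodType k :=
  prod_module (fun c : {c | dle b c} => M (val c)).

Definition hull_mul b c (bc : dle b c) (x : hull_comp b) : hull_comp c :=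
  fun d => x (exist (fun d => dle b d) (val d) (dle_trans bc (valP d))).

Fact hull_mul_is_linear b c (bc : dle b c) : linear (hull_mul bc).
Proof. by []. Qed.

HB.instance Definition _ b c (bc : dle b c) :=
  GRing.isLinear.Build k (hull_comp b) (hull_comp c) *:%R (hull_mul bc)
    (hull_mul_is_linear bc).

Fact hull_mul_id b (bb : dle b b) x : hull_mul bb x = x.
Proof.
apply: (functional_extensionality_dep (A := {d | dle _ d})) => -[d bd]; rewrite /hull_mul /=.
by rewrite (bool_irrelevance (dle_trans _ _) bd).
Qed.

Fact hull_mul_comp b c d (bc : dle b c) (cd : dle c d) (bd : dle b d) x :
  hull_mul cd (hull_mul bc x) = hull_mul bd x.
Proof.
apply: (functional_extensionality_dep (A := {d | dle _ d})) => -[e de]; rewrite /hull_mul /=.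
by congr (x (exist _ _ _)); exact: bool_irrelevance.
Qed.

Definition cofree_hull : gmod k n :=
  @GMod k n hull_comp (fun b c bc => hull_mul bc : {linear _ -> _})
    hull_mul_id hull_mul_comp.

Definition hull_embed_fun b (x : M b) : cofree_hull b := fun c => gshift (val c) x.

Fact hull_embed_is_linear b : linear (@hull_embed_fun b).
Proof.
by move=> c x y; apply: functional_extensionality_dep => d; exact: linearP.
Qed.

HB.instance Definition _ b :=
  GRing.isLinear.Build k (M b) (cofree_hull b) *:%R (@hull_embed_fun b)
    (@hull_embed_is_linear b).

Fact hull_embed_mul b c (bc : dle b c) (x : M b) :
  hull_embed_fun (gmul M bc x) = gmul cofree_hull bc (hull_embed_fun x).
Proof.
apply: (functional_extensionality_dep (A := {d | dle _ d})) => -[d cd]; rewrite /hull_embed_fun /=.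
by rewrite -gshiftE gshift_comp.
Qed.

Definition hull_embed : ghom M cofree_hull :=
  @GHom k n M cofree_hull (fun b => @hull_embed_fun b : {linear _ -> _}) hull_embed_mul.

Lemma hull_embed_inj b : injective (hull_embed b).
Proof.
move=> x y /(congr1 (fun f => f (exist (fun c => dle b c) b (dle_refl b)))).
by rewrite /= /hull_embed_fun /= !gshift_id.
Qed.

Fact ghom_id_mul b c (bc : dle b c) (x : M b) : idfun (gmul M bc x) = gmul M bc (idfun x).
Proof. by []. Qed.

Definition ghom_id : ghom M M := @GHom k n M M (fun b => idfun : {linear _ -> _}) ghom_id_mul.

(** The identity of [M] extends along the embedding. Exactness can thus be checked on the hull,
    factor by factor. *)
Lemma ginjective_retract : ginjective M ->
  exists r : ghom cofree_hull M, forall b x, r b (hull_embed b x) = x.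
Proof. by move=> /(_ _ _ hull_embed ghom_id) /(_ hull_embed_inj). Qed.

End CofreeHull.

(** * Koszul complexes *)

Section Koszul.
Variables (k : fieldType) (n : nat) (a : degree n) (i : 'I_n).
Implicit Types (M N : gmod k n) (p q r : nat) (s t : {set 'I_n}) (b : degree n).

Definition shift_deg r t : degree n := [ffun j => a j + (if j \in t then r%:Z else 0)].

Lemma le_shift_deg r r' s t : (r <= r')%N -> s \subset t ->
  dle (shift_deg r s) (shift_deg r' t).
Proof.
move=> rr' /subsetP st; apply/forallP => j; rewrite !ffunE lerD2l.
case: ifP => [/st ->|_]; first by rewrite lez_nat.
by case: ifP.
Qed.

Lemma le_deg_shift r t : dle a (shift_deg r t).
Proof. by apply/forallP => j; rewrite !ffunE lerDl; case: ifP. Qed.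

(** The two degrees are equal, but the types [M (shift_deg r set0)] and [M a] are not convertible;
    inequalities in both directions make [gshift] the passage between them. *)
Lemma shift_deg0_le r : dle (shift_deg r set0) a.
Proof. by apply/forallP => j; rewrite !ffunE inE addr0. Qed.

Lemma shift_degU1_le r v t b : dle (shift_deg r t) b -> a v + r%:Z <= b v ->
  dle (shift_deg r (v |: t)) b.
Proof.
move=> /forallP tb vb; apply/forallP => j; move: (tb j); rewrite !ffunE !inE.
by case: (eqVneq j v) => [->|_] /=; rewrite ?vb.
Qed.

Definition level p t := (i \notin t) && (#|t| == p).

Lemma levelD1 p v t : level p.+1 t -> v \in t -> level p (t :\ v).
Proof.
move=> /andP[it /eqP ct] vt; rewrite /level !inE (negPf it) andbF.
by rewrite -eqSS -ct (cardsD1 v t) vt add1n eqxx.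
Qed.

Lemma levelU1 p v t : v != i -> v \notin t -> level p t -> level p.+1 (v |: t).
Proof.
move=> vi vt /andP[it ct]; rewrite /level !inE negb_or eq_sym vi it.
by rewrite cardsU1 vt (eqP ct) add1n eqxx.
Qed.

Lemma level0P t : reflect (t = set0) (level 0 t).
Proof.
rewrite /level cards_eq0; apply: (iffP andP) => [[_ /eqP]//|->].
by rewrite inE.
Qed.

(* Degree a part of the Koszul cochain complex of the x_j^r, j != i, with
   coefficients in M; only the indices t with [i \notin t] matter. *)
Definition cube M r := forall t, M (shift_deg r t).

Definition koszul M r (c : cube M r) : cube M r :=
  fun t => cobound (fun s => gshift (shift_deg r t) (c s)) t.

Lemma eq_koszul M r p (c d : cube M r) : (forall t, level p t -> c t = d t) ->
  forall t, level p.+1 t -> koszul c t = koszul d t.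
Proof.
by move=> cd t lt; apply: eq_cobound => v vt; rewrite cd ?(levelD1 lt).
Qed.

Lemma gshift_cobound M b c (f : {set 'I_n} -> M b) t :
  gshift c (cobound f t) = cobound (fun s => gshift c (f s)) t.
Proof. by rewrite linear_sum; apply: eq_bigr => v _; rewrite linearZ. Qed.

Lemma gfun_cobound M N (u : ghom M N) b (f : {set 'I_n} -> M b) t :
  u b (cobound f t) = cobound (fun s => u b (f s)) t.
Proof. by rewrite linear_sum; apply: eq_bigr => v _; rewrite linearZ. Qed.

Lemma gshift_koszul M r (c : cube M r) b t : dle (shift_deg r t) b ->
  gshift b (koszul c t) = cobound (fun s => gshift b (c s)) t.
Proof.
move=> tb; rewrite gshift_cobound; apply: eq_cobound => v vt.
by rewrite gshift_comp ?le_shift_deg ?subD1set.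
Qed.

Lemma koszul_koszul M r (c : cube M r) t : koszul (koszul c) t = 0.
Proof.
rewrite -[RHS](cobound_cobound (fun s => gshift (shift_deg r t) (c s)) t).
by apply: eq_cobound => v vt; rewrite gshift_koszul // le_shift_deg ?subD1set.
Qed.

Lemma gfun_koszul M N (u : ghom M N) r (c : cube M r) t :
  u _ (koszul c t) = koszul (fun s => u _ (c s)) t.
Proof. by rewrite gfun_cobound; apply: eq_cobound => v vt; rewrite gfun_shift. Qed.

Lemma koszulD M r (c d : cube M r) t :
  koszul (fun s => c s + d s) t = koszul c t + koszul d t.
Proof. by rewrite -coboundD; apply: eq_cobound => v vt; rewrite linearD. Qed.

Lemma koszulB M r (c d : cube M r) t :
  koszul (fun s => c s - d s) t = koszul c t - koszul d t.
Proof. by rewrite -coboundB; apply: eq_cobound => v vt; rewrite linearB. Qed.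

Lemma koszulZ M r l (c : cube M r) t :
  koszul (fun s => l *: c s) t = l *: koszul c t.
Proof. by rewrite -coboundZ; apply: eq_cobound => v vt; rewrite linearZ. Qed.

(** In the factor of index [b] of the hull, a [j != i] with [a j + r <= b j] is an apex: adding [j]
    to [t] keeps the degree below [b]. The apex depends on [b] alone, so the contractions for all
    [t] form one Koszul cochain [e] of the hull, which the retraction sends to [M]. *)
Lemma koszul_exact M r p (c : cube M r) : ginjective M ->
    (forall t, level p.+2 t -> koszul c t = 0) ->
  exists d : cube M r, forall t, level p.+1 t -> c t = koszul d t.
Proof.
move=> /ginjective_retract[u uK] dc0.
pose f b t : M b := if i \in t then 0 else gshift b (c t).
pose apex b := [pick j | (j != i) && (a j + r%:Z <= b j)].
pose h b t : M b := if apex b is Some j then cone_contraction j (f b) t else 0.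
pose e : cube (cofree_hull M) r := 
  fun t => (fun b : {b | dle (shift_deg r t) b} => h (val b) t) : hull_comp M _.
exists (fun t => u _ (e t)) => t lt.
rewrite -gfun_koszul -[LHS]uK; congr (u _ _).
apply: (functional_extensionality_dep (A := {b | dle _ b})) => -[b tb].
transitivity (cobound (h b) t); last first.
  rewrite /koszul /cobound prod_module_sumE; apply: eq_bigr => v vt.
  by rewrite (gshiftE (le_shift_deg (leqnn r) (subD1set t v))).
rewrite /= /hull_embed_fun /=.
have it : i \notin t by case/andP: lt.
transitivity (f b t); first by rewrite /f (negPf it).
rewrite /h /apex; case: pickP => [j /andP[ji jb]|noj].
  apply: cone_contractionP => jt.
  have L := levelU1 ji jt lt.
  have := congr1 (gshift b) (dc0 _ L).
  rewrite gshift_koszul ?shift_degU1_le // linear0 => <-.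
  apply: eq_cobound => v vt; rewrite /f.
  by case/andP: (levelD1 L vt) => /negPf->.
(* A missing apex is contradictory in positive level: [b] lies above [shift_deg r t], so every
   element of [t] qualifies. *)
have /card_gt0P[j jt] : (0 < #|t|)%N by case/andP: lt => _ /eqP->.
have := noj j; have -> /= : j != i by apply: contraNneq it => <-.
by move: (forallP tb j); rewrite ffunE jt => ->.
Qed.
End Koszul.

(** * Koszul cohomology of a module and torsion of its injective resolution *)

Section Zigzag.
Variables (k : fieldType) (n : nat) (a : degree n) (i : 'I_n).
Variables (M : gmod k n) (E : ginjres M).
Implicit Types (p q r : nat) (s t : {set 'I_n}).
Local Notation cube := (cube a).
Local Notation level := (level i).

Lemma cube_choice (N : gmod k n) r p (P : forall t, N (shift_deg a r t) -> Prop) :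
    (forall t, level p t -> exists y, P t y) ->
  exists c : cube N r, forall t, level p t -> P t (c t).
Proof.
move=> H; have H' t : exists y, level p t -> P t y.
  by have [/H[y]|_] := boolP (level p t); [exists y | exists 0].
by exists (fun t => sval (cid (H' t))) => t; exact: (svalP (cid (H' t))).
Qed.

Lemma gres_d_aug b (y : M b) : gres_d E 0 b (gres_aug E b y) = 0.
Proof. by apply/gres_exact0; exists y. Qed.

Lemma gres_d_d q b (y : E q b) : gres_d E q.+1 b (gres_d E q b y) = 0.
Proof. by apply/gres_exactS; exists y. Qed.

(* In the double complex of the Koszul complexes of the E^q, [zigzag p q c al]
   says that [c], in bidegree (p, q), is joined by a staircase to [al], in
   bidegree p + q of the Koszul complex of M. *)
Fixpoint zigzag r p q : cube (E q) r -> cube M r -> Prop :=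
  match q with
  | 0 => fun c al => forall t, level p t -> c t = gres_aug E _ (al t)
  | q'.+1 => fun c al => exists2 e : cube (E q') r,
      (forall t, level p t -> c t = gres_d E q' _ (e t)) &
      zigzag p.+1 (koszul e) al
  end.

Lemma zigzag_eq r p q (c d : cube (E q) r) (al be : cube M r) :
    (forall t, level p t -> c t = d t) ->
    (forall t, level (p + q) t -> al t = be t) ->
  zigzag p c al -> zigzag p d be.
Proof.
elim: q p c d => [|q IH] p c d cd ab /=.
  by move=> H t lt; rewrite -cd // -ab ?addn0 // H.
case=> e ce H; exists e; first by move=> t lt; rewrite -cd // ce.
by apply: IH H => // t lt; rewrite ab // addnS -addSn.
Qed.

Lemma zigzagZD r p q l (c d : cube (E q) r) (al be : cube M r) :
    zigzag p c al -> zigzag p d be ->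
  zigzag p (fun t => l *: c t + d t) (fun t => l *: al t + be t).
Proof.
elim: q p c d => [|q IH] p c d /=.
  by move=> H H' t lt; rewrite H // H' // linearP.
case=> [e ce H] [f df H']; exists (fun t => l *: e t + f t).
  by move=> t lt; rewrite ce // df // linearP.
by apply: zigzag_eq (IH _ _ _ H H') => // t lt; rewrite koszulD koszulZ.
Qed.

(** These shifts are the transition maps of the direct system of Koszul complexes. *)
Lemma zigzag_shift r r' p q (c : cube (E q) r) (al : cube M r) : (r <= r')%N ->
    zigzag p c al ->
  zigzag p (fun t => gshift (shift_deg a r' t) (c t) : E q (shift_deg a r' t))
           (fun t => gshift (shift_deg a r' t) (al t)).
Proof.
move=> rr'; elim: q p c => [|q IH] p c /=.
  by move=> H t lt; rewrite H // gfun_shift.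
case=> [e ce H]; exists (fun t => gshift (shift_deg a r' t) (e t)).
  by move=> t lt; rewrite ce // gfun_shift.
apply: zigzag_eq (IH _ _ H) => // t lt.
rewrite gshift_koszul ?le_shift_deg //; apply: eq_cobound => v vt.
by rewrite gshift_comp ?le_shift_deg ?subD1set.
Qed.

(** Exactness of the resolution lifts [c] to some [e], and [koszul e] is again a cocycle for both
    differentials, one step down the staircase. *)
Lemma zigzag_to r p q (c : cube (E q) r) :
    (forall t, level p t -> gres_d E q _ (c t) = 0) ->
    (forall t, level p.+1 t -> koszul c t = 0) ->
  exists al, zigzag p c al.
Proof.
elim: q p c => [|q IH] p c dc kc /=.
  apply: (cube_choice (P := fun t y => c t = gres_aug E _ y)) => t lt.
  by apply/gres_exact0; exact: dc.
have [e ce] : exists e : cube (E q) r,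
    forall t, level p t -> c t = gres_d E q _ (e t).
  apply: (cube_choice (P := fun t y => c t = gres_d E q _ y)) => t lt.
  by apply/gres_exactS; exact: dc.
have [al H] : exists al, zigzag p.+1 (koszul e) al; last by exists al, e.
apply: IH => t lt; last exact: koszul_koszul.
by rewrite gfun_koszul -(kc t lt); apply/esym/(eq_koszul ce).
Qed.

Lemma zigzag_koszul r p q (c : cube (E q) r) al : zigzag p c al ->
    (forall t, level p.+1 t -> koszul c t = 0) ->
  forall t, level (p + q).+1 t -> koszul al t = 0.
Proof.
elim: q p c => [|q IH] p c /=.
  move=> H kc t; rewrite addn0 => lt; apply: (@gres_aug_inj _ _ _ E).
  by rewrite linear0 gfun_koszul -(kc t lt); apply/esym/(eq_koszul H).
case=> e _ H _ t lt; apply: IH H _ _ _; last by rewrite addSnnS.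
by move=> s _; exact: koszul_koszul.
Qed.

(** The staircase is climbed in the other direction, with [koszul_exact] on the injectives in place
    of exactness of the resolution. *)
Lemma zigzag_from r p q (al : cube M r) :
    (forall t, level (p + q).+1 t -> koszul al t = 0) ->
  exists c : cube (E q) r, [/\ forall t, level p t -> gres_d E q _ (c t) = 0,
    forall t, level p.+1 t -> koszul c t = 0 & zigzag p c al].
Proof.
elim: q p => [|q IH] p ka /=.
  exists (fun t => gres_aug E _ (al t)); split=> // t lt; first exact: gres_d_aug.
  by rewrite -gfun_koszul ka ?linear0 // addn0.
have [|d [dd kd H]] := IH p.+1; first by move=> t; rewrite addSnnS => /ka.
have [e de] := koszul_exact (gres_injective (g := E) (q := q)) kd.
exists (fun t => gres_d E q _ (e t)); split=> [t lt|t lt|].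
- exact: gres_d_d.
- by rewrite -gfun_koszul -de // dd.
by exists e => //; apply: zigzag_eq H.
Qed.

(** The difference [e - y] is killed by the resolution differential, hence comes from some [z]; then
    [koszul e] is the image of [koszul z], the same situation one step down. *)
Lemma zigzag_cob_to r p q (c : cube (E q.+1) r) al y :
    zigzag p c al -> (forall t, level p t -> c t = gres_d E q _ (y t)) ->
    (forall t, level p.+1 t -> koszul y t = 0) ->
  exists be, forall t, level (p + q.+1) t -> al t = koszul be t.
Proof.
elim: q p c y => [|q IH] p c y /= [e ce H] cy ky.
  have [be eyb] : exists be : cube M r,
      forall t, level p t -> e t - y t = gres_aug E _ (be t).
    apply: (cube_choice (P := fun t u => e t - y t = gres_aug E _ u)) => t lt.
    apply/gres_exact0.
    by rewrite linearB /= -ce // -cy // subrr.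
  exists be => t; rewrite addn1 => lt; apply: (@gres_aug_inj _ _ _ E).
  rewrite -H // gfun_koszul -(eq_koszul eyb lt) koszulB ky // subr0 //.
have [z eyz] : exists z : cube (E q) r,
    forall t, level p t -> e t - y t = gres_d E q _ (z t).
  apply: (cube_choice (P := fun t u => e t - y t = gres_d E q _ u)) => t lt.
  apply/gres_exactS.
  by rewrite linearB /= -ce // -cy // subrr.
have [||be bP] := IH _ _ (koszul z) H; last by exists be => t; rewrite -addSnnS => /bP.
  by move=> t lt; rewrite gfun_koszul -(eq_koszul eyz lt) koszulB ky // subr0.
by move=> t lt; exact: koszul_koszul.
Qed.

(** The lift [e] of [c] is corrected by an element in the kernel of the resolution differential
    until it becomes a Koszul cocycle. *)
Lemma zigzag_cob_from r p q (c : cube (E q.+1) r) al be :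
    zigzag p c al -> (forall t, level (p + q.+1) t -> al t = koszul be t) ->
  exists2 y : cube (E q) r, forall t, level p t -> c t = gres_d E q _ (y t) &
    forall t, level p.+1 t -> koszul y t = 0.
Proof.
elim: q p c => [|q IH] p c /= [e ce H] ab.
  exists (fun t => e t - gres_aug E _ (be t)) => t lt.
    by rewrite linearB /= gres_d_aug subr0 ce.
  by rewrite koszulB -gfun_koszul -ab ?addn1 // H // subrr.
have [|y ey ky] := IH _ _ H; first by move=> t; rewrite addSnnS => /ab.
have [z yz] := koszul_exact (gres_injective (g := E) (q := q)) ky.
exists (fun t => e t - gres_d E q _ (z t)) => t lt.
  by rewrite linearB /= gres_d_d subr0 ce.
by rewrite koszulB -gfun_koszul -yz // -ey // subrr.
Qed.

End Zigzag.

(** * Elements killed by powers of the variables as Koszul cocycles of degree 0 *)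

Section Diagonal.
Variables (k : fieldType) (n : nat) (a : degree n) (i : 'I_n) (M : gmod k n).
Implicit Types (r : nat) (t : {set 'I_n}) (x : M a).

Definition power_torsion r x : Prop :=
  forall j, j != i -> gshift (shift_deg a r [set j]) x = 0.

Definition cube_of r x : cube a M r := fun t => gshift (shift_deg a r t) x.

Lemma cube_of_eq0 r x : cube_of r x set0 = 0 -> x = 0.
Proof.
move=> /(congr1 (gshift a)).
by rewrite linear0 gshift_comp ?shift_deg0_le ?le_deg_shift // gshift_id.
Qed.

Lemma cube_ofK r (c : cube a M r) t :
  level i 0 t -> cube_of r (gshift a (c set0)) t = c t.
Proof.
move=> /level0P ->; rewrite /cube_of.
by rewrite gshift_comp ?shift_deg0_le ?le_deg_shift // gshift_id.
Qed.

Lemma koszul_cube_of r x j :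
  koszul (cube_of r x) [set j] = gshift (shift_deg a r [set j]) x.
Proof.
by rewrite /koszul cobound_set1 gshift_comp ?le_deg_shift // le_shift_deg ?sub0set.
Qed.

(** Level 1 consists of the singletons other than {i}, where the Koszul differential of x is x_j^r
    x. *)
Lemma power_torsionP r x :
  power_torsion r x <-> forall t, level i 1 t -> koszul (cube_of r x) t = 0.
Proof.
split=> [xr t /andP[it /cards1P[j tj]]|H j ji].
  by move: it; rewrite {t}tj inE eq_sym koszul_cube_of => /xr.
by rewrite -koszul_cube_of H // /level inE eq_sym ji cards1.
Qed.

Lemma power_torsion_le r r' x : (r <= r')%N -> power_torsion r x -> power_torsion r' x.
Proof.
move=> rr' xr j ji.
rewrite -(@gshift_comp _ _ _ _ (shift_deg a r [set j])) ?le_deg_shift ?le_shift_deg //.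
by rewrite xr ?linear0.
Qed.

End Diagonal.

(** * Coordinates on the Stanley-Reisner ring *)

Section StanleyReisner.
Variables (k : fieldType) (n : nat) (D : {set {set 'I_n}}).
Hypothesis hD : down_closed D.
Implicit Types (b c : degree n) (m : 'X_{1..n}).
Local Notation SR := (stanley_reisner_ring k D).

Definition mnm_supp m : {set 'I_n} := [set j | (0 < m j)%N].

Lemma prod_varE (t : {set 'I_n}) :
  \prod_(j in t) 'X_j = 'X_[[multinom (j \in t : nat) | j < n]] :> {mpoly k[n]}.
Proof.
rewrite mpolyXE_id big_mkcond; apply: eq_bigr => j _; rewrite mnmE.
by case: (j \in t).
Qed.

Lemma mcoeff_nonface (f : {mpoly k[n]}) m :
  ideal_gen (@nonface_monomial k n D) f -> mnm_supp m \in D -> f@_m = 0.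
Proof.
case=> s sD -> mD; rewrite raddf_sum big_seq big1 // => u /sD[t tD /= ->].
apply/eqP; apply: contraNT tD; rewrite prod_varE -mcoeff_msupp.
rewrite (perm_mem (msuppMX _ _)) => /mapP[m' _ mE].
apply: hD mD; apply/subsetP => j jt.
by rewrite inE mE mnmDE mnmE jt.
Qed.

Lemma mpolyX_nonface m : mnm_supp m \notin D ->
  ideal_gen (@nonface_monomial k n D) 'X_[m].
Proof.
move=> mD; pose t := mnm_supp m.
have -> : 'X_[m] = 'X_[m - [multinom (j \in t : nat) | j < n]] * \prod_(j in t) 'X_j
    :> {mpoly k[n]}.
  rewrite prod_varE -mpolyXD; congr 'X_[_]; apply/mnmP => j.
  by rewrite mnmDE mnmBE mnmE inE; case: (m j) => [|u] //=; rewrite subn1 addn1.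
apply: ideal_genM; exists [:: (1, \prod_(j in t) 'X_j)].
  by move=> u; rewrite inE => /eqP->; exists t.
by rewrite big_seq1 /= mul1r.
Qed.

(* The degrees b with k[D]_b <> 0. *)
Definition face_degree b := [forall j, 0 <= b j] && ([set j | 0 < b j] \in D).

Definition deg_mnm b : 'X_{1..n} := [multinom `|b j|%N | j < n].

Lemma mnm_supp_deg b : (forall j, 0 <= b j) -> mnm_supp (deg_mnm b) = [set j | 0 < b j].
Proof.
by move=> b0; apply/setP => j; rewrite !inE mnmE -ltz_nat gez0_abs.
Qed.

(** A multidegree contains at most one monomial, and none if some entry is negative. *)
Lemma has_degreeE b (p : {mpoly k[n]}) : p \in has_degree b ->
  p = if [forall j, 0 <= b j] then p@_(deg_mnm b) *: 'X_[deg_mnm b] else 0.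
Proof.
move=> /allP pb; apply/mpolyP => m.
have mP : m \in msupp p -> [forall j, 0 <= b j] /\ m = deg_mnm b.
  move=> /pb /forallP mb; split; first by apply/forallP => j; rewrite -(eqP (mb j)).
  by apply/mnmP => j; rewrite mnmE -(eqP (mb j)).
case: ifP => b0.
  rewrite mcoeffZ mcoeffX; case: eqVneq => [->|mb]; first by rewrite mulr1.
  rewrite mulr0; apply/eqP; rewrite mcoeff_eq0; apply/negP => /mP[_ mE].
  by rewrite mE eqxx in mb.
by rewrite mcoeff0; apply/eqP; rewrite mcoeff_eq0; apply/negP => /mP[]; rewrite b0.
Qed.

(** The value 0 outside the face degrees makes the kernel exactly the Stanley-Reisner ideal, so the
    coordinate descends injectively to the quotient. *)
Definition gpoly_coord b (p : gpoly k b) : k^o :=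
  if face_degree b then (val p)@_(deg_mnm b) else 0.

Lemma gpoly_coord_eq0 b (p : gpoly k b) :
  (gpoly_coord p == 0) = (p \in gsubp (gideal (@nonface_monomial k n D)) b).
Proof.
rewrite /gpoly_coord; apply/eqP/asboolP => [|pI].
  have := has_degreeE (valP p); rewrite /face_degree.
  case: ifP => /= [/forallP b0|_ -> _]; last exact: ideal_gen0.
  rewrite -mnm_supp_deg // => pE; case: ifPn => [_ p0|bD _].
    by rewrite pE p0 scale0r; exact: ideal_gen0.
  by rewrite pE -mul_mpolyC; apply/ideal_genM/mpolyX_nonface.
case: ifP => // /andP[/forallP b0 bD]; apply: mcoeff_nonface => //.
by rewrite mnm_supp_deg.
Qed.

Fact gpoly_coord_is_linear b : linear (@gpoly_coord b).
Proof.
move=> l p q; rewrite /gpoly_coord; case: ifP => _; first by rewrite linearP.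
by rewrite scaler0 addr0.
Qed.

HB.instance Definition _ b :=
  GRing.isLinear.Build k (gpoly k b) k^o *:%R (@gpoly_coord b) (@gpoly_coord_is_linear b).

Definition sr_coord b (x : SR b) : k^o := gpoly_coord (quot_repr x).

Lemma sr_coord_proj b (p : gpoly k b) :
  sr_coord (quot_proj (gsubp (gideal (@nonface_monomial k n D)) b) p) = gpoly_coord p.
Proof.
apply/eqP; rewrite -subr_eq0 -[_ - _]linearB gpoly_coord_eq0; exact: quot_reprP.
Qed.

Fact sr_coord_is_linear b : linear (@sr_coord b).
Proof.
move=> l x y; rewrite -[x]quot_reprK -[y]quot_reprK -linearP !sr_coord_proj.
exact: linearP.
Qed.

HB.instance Definition _ b :=
  GRing.isLinear.Build k (SR b) k^o *:%R (@sr_coord b) (@sr_coord_is_linear b).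

Lemma sr_coord_eq0 b (x : SR b) : sr_coord x = 0 -> x = 0.
Proof.
move=> /eqP; rewrite gpoly_coord_eq0 -[quot_repr x]subr0 => /quot_projP.
by rewrite quot_reprK => ->; exact: linear0.
Qed.

Lemma sr_coord_nonface b (x : SR b) : ~~ face_degree b -> sr_coord x = 0.
Proof. by rewrite /sr_coord /gpoly_coord => /negPf->. Qed.

Lemma sr_coord_surj b (l : k) : face_degree b -> exists x : SR b, sr_coord x = l.
Proof.
move=> Fb; have pb : l *: 'X_[deg_mnm b] \in has_degree b.
  apply/allP => m /msuppZ_le; rewrite msuppX inE => /eqP->.
  apply/forallP => j; rewrite mnmE gez0_abs //.
  by case/andP: Fb => /forallP.
exists (quot_proj _ (GPoly pb)).
by rewrite sr_coord_proj /gpoly_coord Fb /= mcoeffZ mcoeffX eqxx mulr1.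
Qed.

Lemma face_degree_le b c : dle b c -> face_degree c -> (forall j, 0 <= b j) ->
  face_degree b.
Proof.
move=> /forallP bc /andP[_ cD] b0; apply/andP; split; first exact/forallP.
by apply: hD cD; apply/subsetP => j; rewrite !inE => /lt_le_trans; apply.
Qed.

(** If [b] has a negative entry, both sides are 0; otherwise [b] is a face degree because [c] is,
    and multiplication by a monomial keeps the coefficient. *)
Lemma sr_coord_shift b c (x : SR b) : dle b c -> face_degree c ->
  sr_coord (gshift c x) = sr_coord x.
Proof.
move=> bc Fc; rewrite (gshiftE bc) -[x]quot_reprK [gmul _ _ _]gquot_mul_proj !sr_coord_proj.
rewrite /gpoly_coord Fc /=.
have [b0|nb0] := boolP [forall j, 0 <= b j]; last first.
  rewrite /face_degree (negPf nb0) (has_degreeE (valP (quot_repr x))) (negPf nb0).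
  by rewrite mulr0 mcoeff0.
rewrite (face_degree_le bc Fc (forallP b0)) mulrC.
have -> : deg_mnm c = (mdiff b c + deg_mnm b)%MM; last by rewrite mcoeffMX.
apply/mnmP => j; rewrite mnmDE !mnmE; apply/eqP; rewrite -eqz_nat PoszD.
rewrite !gez0_abs ?subr_ge0 ?(forallP bc) ?(forallP b0) ?subrK //.
exact: le_trans (forallP b0 j) (forallP bc j).
Qed.

(** * Koszul cohomology of the Stanley-Reisner ring as functions on sets *)

Variables (a : degree n) (i : 'I_n).
Variable E : ginjres SR.
Implicit Types (q r : nat) (s t : {set 'I_n}) (g h : {set 'I_n} -> k^o).
Local Notation level := (level i).

(* The t such that a + r e_t is a nonzero degree of k[D], for r large. *)
Definition admissible t : bool :=
  ([set j | a j < 0] \subset t) && (t :|: [set j | 0 < a j] \in D).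

(** Adding r makes every coordinate in [t] positive and the others keep their sign: negative
    coordinates must lie in [t], and the positive support becomes [t] together with that of [a]. *)
Lemma face_degree_shift r t : (forall j, `|a j| < r%:Z) ->
  face_degree (shift_deg a r t) = admissible t.
Proof.
move=> ar; congr (_ && (_ \in D)).
  apply/forallP/subsetP => [H j|H j].
    rewrite inE ltNge; apply: contraNT => jt.
    by have := H j; rewrite ffunE (negPf jt) addr0.
  rewrite ffunE; case: ifP => jt.
    by move: (ar j); rewrite ltr_norml => /andP[+ _]; rewrite -subr_gt0 opprK => /ltW.
  by rewrite addr0 leNgt; apply/negP => aj; move: (H j); rewrite inE aj jt => /(_ isT).
apply/setP => j; rewrite !inE ffunE; case: (j \in t) => /=; last by rewrite addr0.
by move: (ar j); rewrite ltr_norml => /andP[+ _]; rewrite -subr_gt0 opprK.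
Qed.

(** At an inadmissible set the Koszul component is zero: functions vanish there, and no equation is
    imposed there. *)
Definition set_cocycle q g : Prop :=
  (forall t, level q t -> ~~ admissible t -> g t = 0) /\
  (forall t, level q.+1 t -> admissible t -> cobound g t = 0).

Definition set_coboundary q g : Prop :=
  match q with
  | 0 => forall t, level 0 t -> g t = 0
  | q'.+1 => exists2 h, (forall t, level q' t -> ~~ admissible t -> h t = 0) &
      forall t, level q t -> admissible t -> g t = cobound h t
  end.

Definition power_coboundary r q : E q a -> Prop :=
  match q with
  | 0 => fun x => x = 0
  | q'.+1 => fun x => exists2 y, power_torsion i r y & x = gres_d E q' a y
  end.

(** The staircase runs from bidegree (0, q), where [x] sits, to level [q] of the Koszul complex of
    k[D], where [g] gives the coordinates. It is a relation because only the classes determine each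
    other. *)
Definition represents r q (x : E q a) g : Prop :=
  exists2 al : cube a SR r, zigzag i 0 (cube_of r x : cube a (E q) r) al &
    forall t, level q t -> g t = sr_coord (al t).

Lemma representsZD r q l (x y : E q a) g h : represents r x g -> represents r y h ->
  represents r (l *: x + y) (fun t => l *: g t + h t).
Proof.
move=> [al H gal] [be H' hbe]; exists (fun t => l *: al t + be t).
  by apply: zigzag_eq (zigzagZD l H H') => // t _; rewrite /cube_of linearP.
by move=> t lt /=; rewrite linearP gal // hbe.
Qed.

Section LargePower.
Variable r : nat.
Hypothesis ar : forall j, `|a j| < r%:Z.

Lemma sr_coord_koszul (al : cube a SR r) t : admissible t ->
  sr_coord (koszul al t) = cobound (fun s => sr_coord (al s) : k^o) t.
Proof.
move=> At; rewrite /koszul /cobound linear_sum; apply: eq_bigr => v vt.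
rewrite linearZ /= sr_coord_shift ?face_degree_shift //.
by rewrite le_shift_deg ?subD1set.
Qed.

Lemma sr_coord_inadmissible (al : cube a SR r) t : ~~ admissible t -> sr_coord (al t) = 0.
Proof. by move=> At; rewrite sr_coord_nonface // face_degree_shift. Qed.

Lemma sr_coord_lift q g : (forall t, level q t -> ~~ admissible t -> g t = 0) ->
  exists al : cube a SR r, forall t, level q t -> sr_coord (al t) = g t.
Proof.
move=> g0; apply: (cube_choice (P := fun t (y : SR _) => sr_coord y = g t)) => t lt.
have [At|At] := boolP (admissible t); last by exists 0; rewrite /= linear0 g0.
by apply: sr_coord_surj; rewrite // face_degree_shift.
Qed.

(** The stabilisation of the direct limit: admissibility is the same for r and r', so the transition
    map does not change coordinates. *)
Lemma represents_le r' q (x : E q a) g : (r <= r')%N ->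
  represents r x g -> represents r' x g.
Proof.
move=> rr' [al H gal].
have ar' j : `|a j| < r'%:Z by apply: lt_le_trans (ar j) _; rewrite lez_nat.
exists (fun t => gshift (shift_deg a r' t) (al t)).
  apply: zigzag_eq (zigzag_shift rr' H) => // t _.
  by rewrite /cube_of gshift_comp ?le_deg_shift ?le_shift_deg.
move=> t lt; rewrite gal //.
have [At|At] := boolP (admissible t).
  by rewrite sr_coord_shift ?le_shift_deg ?face_degree_shift.
by rewrite !sr_coord_nonface ?face_degree_shift.
Qed.

(** This and the next three lemmas are the staircase lemmas in coordinates; together they match the
    cohomology of the elements killed by all x_j^r with that of the set functions. *)
Lemma represents_exists q (x : E q a) : power_torsion i r x -> gres_d E q a x = 0 ->
  exists2 g, set_cocycle q g & represents r x g.
Proof.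
move=> /power_torsionP kx dx.
have [|al H] := zigzag_to (p := 0) (c := cube_of r x : cube a (E q) r) _ kx.
  by move=> t _; rewrite /cube_of gfun_shift dx linear0.
exists (fun t => sr_coord (al t)); last by exists al.
split=> [t _|t lt At]; first exact: sr_coord_inadmissible.
by rewrite -sr_coord_koszul // (zigzag_koszul H kx) // linear0.
Qed.

Lemma exists_represented q g : set_cocycle q g ->
  exists x : E q a, [/\ power_torsion i r x, gres_d E q a x = 0 & represents r x g].
Proof.
move=> [g0 dg]; have [al gal] := sr_coord_lift g0.
have [|c [dc kc H]] := zigzag_from E (i := i) (p := 0) (q := q) (al := al).
  move=> t lt; apply: sr_coord_eq0.
  have [At|At] := boolP (admissible t); last exact: sr_coord_inadmissible.
  rewrite sr_coord_koszul // -[RHS](dg t lt At).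
  by apply: eq_cobound => v vt; rewrite gal // (levelD1 lt).
exists (gshift a (c set0)); split.
- apply/(@power_torsionP _ _ _ _ _ r) => t lt; rewrite -[RHS](kc t lt).
  by apply: (@eq_koszul _ _ a i _ r 0) => // s ls; rewrite (cube_ofK _ ls).
- by rewrite gfun_shift dc ?linear0 //; apply/level0P.
exists al; last by move=> t lt; rewrite gal.
by apply: zigzag_eq H => // t lt; rewrite (cube_ofK _ lt).
Qed.

Lemma represents_coboundary q (x : E q a) g :
  represents r x g -> power_coboundary r x -> set_coboundary q g.
Proof.
case: q x => [|q] x /= [al H gal].
  move=> x0 t lt; rewrite gal //; have := H t lt.
  rewrite /cube_of x0 linear0 => /esym; rewrite -(linear0 (gres_aug E _)).
  by move/(@gres_aug_inj _ _ _ E) ->; rewrite linear0.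
case=> y /power_torsionP ky xy.
have [|be ab] := zigzag_cob_to H _ ky.
  by move=> t _; rewrite /cube_of xy gfun_shift.
exists (fun t => sr_coord (be t)); first by move=> t _; exact: sr_coord_inadmissible.
by move=> t lt At; rewrite gal // ab // sr_coord_koszul.
Qed.

Lemma coboundary_represented q (x : E q a) g :
  represents r x g -> set_coboundary q g -> power_coboundary r x.
Proof.
case: q x => [|q] x /= [al H gal].
  have l0 : level 0 set0 by exact/level0P.
  move=> /(_ _ l0); rewrite gal // => /sr_coord_eq0 al0.
  by apply: (@cube_of_eq0 _ _ _ _ r); rewrite H // al0 linear0.
case=> h h0 gh; have [be bh] := sr_coord_lift h0.
have [|y cy ky] := zigzag_cob_from (p := 0) (q := q) (be := be) H.
  move=> t lt; apply/eqP; rewrite -subr_eq0; apply/eqP/sr_coord_eq0.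
  have [At|At] := boolP (admissible t); last first.
    by rewrite sr_coord_nonface // face_degree_shift.
  rewrite linearB /= -gal // gh // sr_coord_koszul //.
  apply/eqP; rewrite subr_eq0; apply/eqP/eq_cobound => v vt.
  by rewrite bh // (levelD1 lt).
have l0 : level 0 set0 by exact/level0P.
exists (gshift a (y set0)).
  apply/(@power_torsionP _ _ _ _ _ r) => t lt; rewrite -[RHS](ky t lt).
  by apply: (@eq_koszul _ _ a i _ r 0) => // s ls; rewrite (cube_ofK _ ls).
apply/eqP; rewrite -subr_eq0; apply/eqP/(@cube_of_eq0 _ _ _ _ r).
rewrite /cube_of linearB /= -!gfun_shift -[gshift _ x]/(cube_of r x set0) cy //.
by rewrite -[gshift _ (gshift a _)]/(cube_of r _ set0) (cube_ofK _ l0) subrr.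
Qed.

End LargePower.
End StanleyReisner.

(** * Torsion with respect to the vertex prime *)

Section Torsion.
Variables (k : fieldType) (n : nat) (i : 'I_n).
Implicit Types (m : 'X_{1..n}) (f g : {mpoly k[n]}) (X : {mpoly k[n]} -> Prop).

Lemma ideal_gen_mem X f : X f -> ideal_gen X f.
Proof.
move=> Xf; exists [:: (1, f)]; last by rewrite big_seq1 mul1r.
by move=> u; rewrite inE => /eqP->.
Qed.

Lemma ideal_pow_varX j r : j != i -> ideal_pow (@vertex_prime k n i) r ('X_j ^+ r).
Proof.
move=> ji; elim: r => [|r IH] //=; apply: ideal_gen_mem.
exists ('X_j ^+ r), 'X_j; split=> //; last by rewrite exprSr.
by apply: ideal_gen_mem; exists j.
Qed.

Definition codeg m : nat := \sum_(j < n | j != i) m j.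

Lemma codegD m m' : codeg (m + m')%MM = (codeg m + codeg m')%N.
Proof. by rewrite -big_split; apply: eq_bigr => j _; rewrite mnmDE. Qed.

(** A bound on supports that every element of the r-th power of the vertex prime satisfies. *)
Definition order_ge r f := forall m, m \in msupp f -> (r <= codeg m)%N.

Lemma order_geM r r' f g : order_ge r f -> order_ge r' g -> order_ge (r + r') (f * g).
Proof.
move=> fr gr m /msuppM_le/allpairsP[[m1 m2] /= [/fr h1 /gr h2 ->]].
by rewrite codegD leq_add.
Qed.

Lemma order_ge_ideal_gen r X : (forall f, X f -> order_ge r f) ->
  forall f, ideal_gen X f -> order_ge r f.
Proof.
move=> Xr f [s sX ->]; elim: s sX => [|u s IH] sX m; first by rewrite big_nil msupp0.
rewrite big_cons => /msuppD_le; rewrite mem_cat => /orP[|].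
  apply: (@order_geM 0 r) => //; apply: Xr; apply: sX; exact: mem_head.
by apply: IH => v vs; apply: sX; rewrite inE vs orbT.
Qed.

Lemma order_ge_ideal_pow r f : ideal_pow (@vertex_prime k n i) r f -> order_ge r f.
Proof.
elim: r f => [|r IH] f //=; apply: order_ge_ideal_gen => _ [g [h [/IH gr hi ->]]].
rewrite -addn1; apply: order_geM => //.
apply: order_ge_ideal_gen hi => _ [j ji ->] m; rewrite msuppX inE => /eqP->.
by rewrite /codeg (bigD1 j) //= mnm1E eqxx.
Qed.

(** In one direction, x_j^r lies in the r-th power of the prime. In the other, the pigeonhole
    principle gives a factor x_j^r in any monomial of the power n r. *)
Lemma gtorsionP (a : degree n) (M : gmod k n) (x : M a) :
  gtorsion (@vertex_prime k n i) x <-> exists r, power_torsion i r x.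
Proof.
split=> [[r xr]|[r0 xr0]].
  exists r => j ji; have le := le_deg_shift a r [set j].
  rewrite (gshiftE le) xr //; have -> : mdiff a (shift_deg a r [set j]) = (U_(j) *+ r)%MM.
    apply/mnmP => l; rewrite mnmE ffunE addrAC subrr add0r inE mulmnE mnm1E eq_sym.
    by case: eqVneq; rewrite ?mul1n ?mul0n.
  by rewrite -mpolyXn; exact: ideal_pow_varX.
(* With the successor, exponents below [r] are at most [r0], and [n * r0 < n * r] is strict because
   [i] witnesses that n is positive. *)
pose r := r0.+1; have xr : power_torsion i r x by exact: power_torsion_le xr0.
exists (n * r)%N => b ab /order_ge_ideal_pow; move=> /(_ (mdiff a b)).
rewrite msuppX mem_head => /(_ isT) rb.
have [j /andP[ji jr]] : exists j, (j != i) && (r <= mdiff a b j)%N.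
  apply/existsP; apply: contraTT rb; rewrite negb_exists => /forallP H.
  rewrite -ltnNge (@leq_ltn_trans (\sum_(j < n | j != i) r0)) //.
    apply: leq_sum => j ji; move: (H j).
    by rewrite ji /= -ltnNge.
  rewrite sum_nat_const (@leq_ltn_trans (n * r0)) //.
    by rewrite leq_mul2r -[X in (_ <= X)%N]card_ord max_card orbT.
  by rewrite ltn_mul2l /r ltnSn (leq_ltn_trans _ (ltn_ord i)).
have jb : dle (shift_deg a r [set j]) b.
  apply/forallP => l; rewrite ffunE inE; case: eqVneq => [->|_]; last by rewrite addr0 (forallP ab).
  by move: jr; rewrite mnmE -lez_nat gez0_abs ?subr_ge0 ?(forallP ab) // lerBrDl.
by rewrite -(gshiftE ab) -(gshift_comp x _ jb) ?le_deg_shift // xr // linear0.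
Qed.

End Torsion.

(** * Comparison with the cochains of a link *)

Section LinkCochains.
Variables (k : fieldType) (n : nat).
Implicit Types (G L : {set {set 'I_n}}) (s t u : {set 'I_n}).

(** Extension by zero to all sets; it is the inner sum of [coboundary], which thereby becomes a
    [cobound]. *)
Definition cochain_val G m (f : cochain k G m) u : k^o := \sum_(r : face G m | val r == u) f r.

Lemma cochain_val_face G m (f : cochain k G m) (r : face G m) : cochain_val f (val r) = f r.
Proof.
rewrite /cochain_val (bigD1 r) //= big1 ?addr0 // => u /andP[/eqP/val_inj ->].
by rewrite eqxx.
Qed.

Lemma cochain_val_out G m (f : cochain k G m) u : u \notin G -> cochain_val f u = 0.
Proof.
by move=> uG; rewrite /cochain_val big1 // => r /eqP ru; case/andP: (valP r); rewrite ru (negPf uG).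
Qed.

Lemma cochain_valZD G m l (f g : cochain k G m) u :
  cochain_val (l *: f + g) u = l *: cochain_val f u + cochain_val g u.
Proof.
by rewrite scaler_sumr -big_split; apply: eq_bigr => r _; rewrite !ffunE.
Qed.

Lemma coboundaryE G m (f : cochain k G m) (r : face G m.+1) :
  coboundary f r = cobound (cochain_val f) (val r).
Proof. by rewrite ffunE. Qed.

Lemma coboundary_coboundary G m (f : cochain k G m) :
  down_closed G -> coboundary (coboundary f) = 0.
Proof.
move=> hG; apply/ffunP => r; rewrite coboundaryE [RHS]ffunE.
rewrite -[RHS](cobound_cobound (cochain_val f) (val r)); apply: eq_cobound => v vr.
have rv : (val r :\ v \in G) && (#|val r :\ v| == m.+1).
  have /andP[rG /eqP rm] := valP r; rewrite (hG _ _ _ rG) ?subD1set //=.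
  by move: rm; rewrite (cardsD1 v) vr add1n => -[->].
rewrite -[X in cochain_val _ X]/(val (exist (fun u => (u \in G) && (#|u| == m.+1)) _ rv)).
by rewrite cochain_val_face coboundaryE.
Qed.

Lemma down_closed_link L s : down_closed L -> down_closed (link L s).
Proof.
move=> hL t u ut; rewrite !inE => /andP[ts tL].
by rewrite (disjointWl ut ts) (hL _ _ _ tL) // setSU.
Qed.

Variable s : {set 'I_n}.

(** The parity of the number of pairs w < v with w in [s] and v in [u], that is, the sign of the
    shuffle of [u] and [s] when they are disjoint. *)
Definition link_sign u : k := \prod_(v in u) incidence k v s.

Lemma link_signK u : link_sign u * link_sign u = 1.
Proof. by rewrite -big_split big1 // => v _; exact: incidenceK. Qed.

Lemma incidence_link v t : s \subset t ->
  incidence k v t = incidence k v s * incidence k v (t :\: s).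
Proof.
move=> st; rewrite /incidence -exprD; congr (_ ^+ _).
rewrite -(cardsID s); congr (_ + _)%N; apply: eq_card => w; rewrite !inE.
  by case: (boolP (w \in s)) => [/(subsetP st)->|_]; rewrite ?andbT ?andbF.
by rewrite andbA.
Qed.

Variable L : {set {set 'I_n}}.
Local Notation G := (link L s).

Definition link_ext m (f : cochain k G m) t : k^o :=
  if s \subset t then link_sign (t :\: s) * cochain_val f (t :\: s) else 0.

Lemma link_extZD m l (f g : cochain k G m) t :
  link_ext (l *: f + g) t = l *: link_ext f t + link_ext g t.
Proof.
rewrite /link_ext; case: ifP => _; last by rewrite scaler0 addr0.
by rewrite cochain_valZD mulrDr scalerAr.
Qed.

Lemma link_ext_sum m (J : Type) (e : seq J) (c : J -> k) (f : J -> cochain k G m) t :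
  link_ext (\sum_(j <- e) c j *: f j) t = \sum_(j <- e) c j *: link_ext (f j) t.
Proof.
elim: e => [|j e IH]; last by rewrite !big_cons link_extZD IH.
rewrite !big_nil /link_ext; case: ifP => // _.
by rewrite /cochain_val big1 ?mulr0 // => r _; rewrite ffunE.
Qed.

Lemma setDUK t u : u \subset t -> (t :\: u) :|: u = t.
Proof. by move=> ut; rewrite -[X in _ :|: X](setIidPr ut) setUC setID. Qed.

Lemma setUDK t u : [disjoint u & t] -> (u :|: t) :\: t = u.
Proof.
by move=> ut; rewrite setDUl setDv setU0; apply/setDidPl.
Qed.

Lemma link_ext_face m (f : cochain k G m) (r : face G m) :
  link_ext f (val r :|: s) = link_sign (val r) * f r.
Proof.
have /andP[+ _] := valP r; rewrite inE => /andP[rs _].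
by rewrite /link_ext subsetUr setUDK // cochain_val_face.
Qed.

Lemma link_ext_out m (f : cochain k G m) t : t \notin L -> link_ext f t = 0.
Proof.
move=> tL; rewrite /link_ext; case: ifP => // st.
rewrite cochain_val_out ?mulr0 // inE negb_and orbC.
by rewrite setDUK // tL.
Qed.

(** Removing a vertex of [s] leaves the domain of the extension, so only vertices outside [s]
    contribute; for these the extra factor [incidence k v s] of [incidence_link] is absorbed by
    [link_sign]. *)
Lemma cobound_link_ext m (f : cochain k G m) t : s \subset t ->
  cobound (link_ext f) t = link_sign (t :\: s) * cobound (cochain_val f) (t :\: s).
Proof.
move=> st; rewrite mulr_sumr /cobound (bigID (mem s)) /= big1 ?add0r => [|v /andP[vt vs]].
  rewrite [RHS](eq_bigl (fun v => (v \in t) && (v \notin s))); last by move=> v; rewrite inE andbC.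
  apply: eq_bigr => v /andP[vt vs]; have st' : s \subset t :\ v by rewrite subsetD1 st.
  have ts : v \in t :\: s by rewrite inE vs.
  rewrite /link_ext st' setDDl [[set v] :|: s]setUC -setDDl (incidence_link v st).
  rewrite /link_sign [X in _ = X * _](big_setD1 v) //=.
  by rewrite /GRing.scale /= -!mulrA; congr (_ * _); exact: mulrCA.
by rewrite /link_ext subsetD1 vs andbF scaler0.
Qed.

End LinkCochains.

(** * Link cochains as functions on admissible sets *)

Section LinkModel.
Variables (k : fieldType) (n : nat) (D : {set {set 'I_n}}) (a : degree n) (i : 'I_n).
Variables (L : {set {set 'I_n}}) (s : {set 'I_n}).
Implicit Types (t u : {set 'I_n}) (g h : {set 'I_n} -> k^o) (m q : nat).
Hypothesis hL : down_closed L.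
Hypothesis iL : forall t, t \in L -> i \notin t.
Hypothesis admissibleE : forall t, i \notin t ->
  admissible D a t = (s \subset t) && (t \in L).
Local Notation G := (link L s).

(** Removing [s] is the bijection from admissible sets to faces of the link, and the source of the
    shift by the size of [s]. *)
Lemma link_faceP q m t : q = (#|s| + m)%N -> level i q t -> admissible D a t ->
  exists r : face G m, t = val r :|: s.
Proof.
move=> -> /andP[it /eqP tm]; rewrite admissibleE // => /andP[st tL].
suff rP : (t :\: s \in G) && (#|t :\: s| == m).
  by exists (exist (fun u => (u \in G) && (#|u| == m)) _ rP); rewrite /= setDUK.
rewrite inE setDUK // tL andbT cardsD (setIidPr st) tm addKn eqxx andbT.
by rewrite disjoints_subset subsetDr.
Qed.

Lemma face_admissible q m (r : face G m) : q = (#|s| + m)%N ->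
  level i q (val r :|: s) && admissible D a (val r :|: s).
Proof.
move=> ->; have /andP[+ /eqP rm] := valP r; rewrite inE => /andP[rs rL].
rewrite admissibleE ?iL // subsetUr rL /level iL //= andbT.
by rewrite cardsU rm (disjoint_setI0 rs) cards0 subn0 addnC.
Qed.

Lemma link_ext_inadmissible m (f : cochain k G m) t :
  i \notin t -> ~~ admissible D a t -> link_ext f t = 0.
Proof.
move=> it; rewrite admissibleE // negb_and => /orP[/negPf st|/link_ext_out//].
by rewrite /link_ext st.
Qed.

Lemma cobound_link_ext_face m (f : cochain k G m) (r : face G m.+1) :
  cobound (link_ext f) (val r :|: s) = link_ext (coboundary f) (val r :|: s).
Proof.
have /andP[+ _] := valP r; rewrite inE => /andP[rs _].
by rewrite cobound_link_ext ?subsetUr // link_ext_face setUDK // coboundaryE.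
Qed.

Definition link_restr m g : cochain k G m :=
  [ffun r => link_sign k s (val r) * g (val r :|: s)].

Lemma link_restrK q m g t : q = (#|s| + m)%N -> level i q t ->
  (~~ admissible D a t -> g t = 0) -> link_ext (link_restr m g) t = g t.
Proof.
move=> qm lt g0; have [At|At] := boolP (admissible D a t).
  have [r ->] := link_faceP qm lt At.
  by rewrite link_ext_face ffunE mulrA link_signK mul1r.
by rewrite g0 // link_ext_inadmissible //; case/andP: lt.
Qed.

Lemma link_extK m (f : cochain k G m) : link_restr m (link_ext f) = f.
Proof.
by apply/ffunP => r; rewrite ffunE link_ext_face mulrA link_signK mul1r.
Qed.

Lemma cocyclesP m (f : cochain k G m) :
  reflect (coboundary f = 0) (f \in cocycles k G m).
Proof. by rewrite memv_ker lfunE; exact: eqP. Qed.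

Lemma link_ext0 m t : link_ext (0 : cochain k G m) t = 0.
Proof.
by have := link_ext_sum [::] (fun=> 0) (fun _ : nat => (0 : cochain k G m)) t; rewrite !big_nil.
Qed.

Lemma set_cocycle_link_ext q m (f : cochain k G m) : q = (#|s| + m)%N ->
  f \in cocycles k G m -> set_cocycle D a i q (link_ext f).
Proof.
move=> qm /cocyclesP df; split=> t lt At.
  by apply: link_ext_inadmissible At; case/andP: lt.
have qm' : q.+1 = (#|s| + m.+1)%N by rewrite addnS qm.
have [r ->] := link_faceP qm' lt At.
by rewrite cobound_link_ext_face df link_ext0.
Qed.

Lemma set_cocycle_ext q m g : q = (#|s| + m)%N -> set_cocycle D a i q g ->
  exists2 f : cochain k G m, f \in cocycles k G m &
    forall t, level i q t -> link_ext f t = g t.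
Proof.
move=> qm [g0 dg]; have fg t : level i q t -> link_ext (link_restr m g) t = g t.
  by move=> lt; rewrite (link_restrK qm lt) // => /(g0 _ lt).
exists (link_restr m g) => //; apply/cocyclesP/ffunP => r.
have qm' : q.+1 = (#|s| + m.+1)%N by rewrite addnS qm.
have /andP[lt At] := face_admissible r qm'.
have := dg _ lt At; rewrite -(eq_cobound (f := link_ext (link_restr m g))); last first.
  by move=> v vt; rewrite fg // (levelD1 lt).
rewrite cobound_link_ext_face link_ext_face => /(congr1 ( *%R (link_sign k s (val r)))).
by rewrite mulr0 mulrA link_signK mul1r => ->; rewrite ffunE.
Qed.

Lemma set_coboundary_link_ext q m (f : cochain k G m) : q = (#|s| + m)%N ->
  set_coboundary D a i q (link_ext f) <-> f \in coboundaries k G m.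
Proof.
case: m f => [|m] f qm /=.
  rewrite memv0; split=> [fb|/eqP->]; last first.
    case: q {qm} => [|q] /= => [t _|]; first exact: link_ext0.
    exists (fun=> 0) => // t _ _; rewrite link_ext0 cobound0 //.
  apply/eqP; rewrite -[f]link_extK; apply/ffunP => r; rewrite !ffunE.
  have /andP[lt At] := face_admissible r qm.
  case: q qm fb lt => [|q] qm /= fb lt; first by rewrite fb ?mulr0.
  (* The only face of cardinality 0 is empty, so the set is [s] itself; without one of its vertices
     it is inadmissible, and [h] vanishes there. *)
  have [h h0 ->] := fb; rewrite // /cobound big1 ?mulr0 // => v vt.
  rewrite h0 ?scaler0 ?(levelD1 lt) // admissibleE; last first.
    by case/andP: (levelD1 lt vt).
  have /andP[_ /eqP/cards0_eq r0] := valP r.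
  by move: vt; rewrite r0 set0U subsetD1 => ->; rewrite andbF.
case: q qm => [|q]; rewrite addnS // => -[qm] /=.
have qm' : q.+1 = (#|s| + m.+1)%N by rewrite addnS qm.
split=> [[h h0 fh]|/memv_imgP[f' _]]; last first.
  rewrite lfunE /= => ->; exists (link_ext f') => t lt At.
    by apply: link_ext_inadmissible At; case/andP: lt.
  by have [r ->] := link_faceP qm' lt At; rewrite cobound_link_ext_face.
apply/memv_imgP; exists (link_restr m h); rewrite ?memvf // lfunE /=.
rewrite -[f]link_extK -[RHS]link_extK; apply/ffunP => r.
have /andP[lt At] := face_admissible r qm'.
rewrite [LHS]ffunE [RHS]ffunE fh // -cobound_link_ext_face; congr (_ * _).
apply: eq_cobound => v vt; have lv := levelD1 lt vt.
by rewrite (link_restrK qm lv) // => /(h0 _ lv).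
Qed.

Lemma coboundaries_sub m : (coboundaries k G m <= cocycles k G m)%VS.
Proof.
case: m => [|m] /=; first exact: sub0v.
apply/subvP => f /memv_imgP[f' _]; rewrite lfunE /= => ->.
by apply/cocyclesP/coboundary_coboundary/down_closed_link.
Qed.

End LinkModel.

(** * From set functions to local cohomology *)

Section LocalCohomologyOfLink.
Variables (k : fieldType) (n : nat) (D : {set {set 'I_n}}) (a : degree n) (i : 'I_n).
Hypothesis hD : down_closed D.
Variable E : ginjres (stanley_reisner_ring k D).
Implicit Types (q r m : nat) (t : {set 'I_n}) (g : {set 'I_n} -> k^o).
Local Notation I := (@vertex_prime k n i).

Lemma degree_bound : exists r0, forall r, (r0 <= r)%N -> forall j, `|a j| < r%:Z.
Proof.
exists (\max_j `|a j|%N).+1 => r rr j; rewrite -abszE ltz_nat.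
by apply: leq_trans rr; rewrite ltnS (leq_bigmax j).
Qed.

Lemma power_coboundary_le r r' q (x : E q a) : (r <= r')%N ->
  power_coboundary i r x -> power_coboundary i r' x.
Proof.
by case: q x => [|q] x rr' //= [y yr ->]; exists y => //; exact: power_torsion_le yr.
Qed.

Lemma lc_coboundaryP q (x : E q a) :
  lc_coboundary I x <-> exists r, power_coboundary i r x.
Proof.
case: q x => [|q] x /=; first by split=> [->|[_ ->]] //; exists 0%N.
split=> [[y /gtorsionP[r yr] ->]|[r [y yr ->]]]; first by exists r, y.
by exists y => //; apply/gtorsionP; exists r.
Qed.

Lemma lc_vanishes_set q :
    (forall g, set_cocycle D a i q g -> set_coboundary D a i q g) ->
  lc_vanishes I E q a.
Proof.
move=> gb x [/gtorsionP[r1 xr1] dx]; have [r0 ar] := degree_bound.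
have rP := ar _ (leq_maxl r0 r1).
have [g gc xg] := represents_exists hD rP (power_torsion_le (leq_maxr r0 r1) xr1) dx.
apply/lc_coboundaryP; exists (maxn r0 r1).
by apply: (coboundary_represented hD rP xg); exact: gb.
Qed.

Lemma lc_has_dim0 q : lc_vanishes I E q a -> lc_has_dim I E q a 0.
Proof.
move=> H; exists (fun=> 0); split=> [[]|x /H xb|c _ []] //.
by exists (fun=> 0); rewrite big_ord0 subr0.
Qed.

Lemma represents_sum r (J : Type) (e : seq J) q (c : J -> k) (x : J -> E q a)
    (g : J -> {set 'I_n} -> k^o) : (forall j, `|a j| < r%:Z) ->
    (forall j, represents i r (x j) (g j)) ->
  represents i r (\sum_(j <- e) c j *: x j) (fun t => \sum_(j <- e) c j *: g j t).
Proof.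
move=> ar H; elim: e => [|j e IH].
  (* Whatever function [h] represents 0, subtracting it from itself shows that the zero function
     does too. *)
  have [||h _ hr] := represents_exists hD ar (i := i) (E := E) (q := q) (x := 0).
  - by move=> j _; exact: linear0.
  - exact: linear0.
  have [al al0 hal] := representsZD hD (-1) hr hr.
  exists al; last by move=> t lt; rewrite -hal // big_nil scaleN1r addNr.
  by apply: zigzag_eq al0 => // t _; rewrite big_nil scaler0 addr0.
have [al al0 hal] := representsZD hD (c j) (H j) IH.
exists al; last by move=> t lt; rewrite -hal // big_cons.
by apply: zigzag_eq al0 => // t _; rewrite big_cons.
Qed.

(** A basis of a complement [U] of the coboundaries in the cocycles is lifted to torsion cocycles of
    the resolution, whose classes form the required basis. *)
Lemma lc_has_dim_link (L : {set {set 'I_n}}) (s : {set 'I_n}) q m :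
    down_closed L -> (forall t, t \in L -> i \notin t) ->
    (forall t : {set 'I_n}, i \notin t -> admissible D a t = (s \subset t) && (t \in L)) ->
    q = (#|s| + m)%N ->
  lc_has_dim I E q a
    (\dim (cocycles k (link L s) m) - \dim (coboundaries k (link L s) m)).
Proof.
move=> hL iL AE qm; set Z := cocycles _ _ _; set B := coboundaries _ _ _.
have BZ : (B <= Z)%VS by exact: coboundaries_sub.
pose U := (Z :\: B)%VS.
have -> : (\dim Z - \dim B)%N = \dim U.
  by rewrite -(dimv_cap_compl Z B) (capv_idPr BZ) addKn.
have [r0 ar] := degree_bound.
pose f (j : 'I_(\dim U)) : cochain k (link L s) m := (vbasis U)`_j.
have fZ j : f j \in Z.
  apply: (subvP (diffvSl Z B)); apply: vbasis_mem; apply: mem_nth.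
  by rewrite size_tuple.
have fx j : exists x : E q a, [/\ power_torsion i r0 x, gres_d E q a x = 0 &
    represents i r0 x (link_ext (f j))].
  apply: exists_represented => //; first exact: ar.
  exact: (set_cocycle_link_ext AE qm).
pose x j := sval (cid (fx j)).
have xP j : [/\ power_torsion i r0 (x j), gres_d E q a (x j) = 0 &
    represents i r0 (x j) (link_ext (f j))] by exact: (svalP (cid (fx j))).
(* The lifts are made once with [r0], but the torsion elements met below may need a larger
   exponent. *)
have xr r (rr : (r0 <= r)%N) c : represents i r (\sum_j c j *: x j)
    (link_ext (\sum_j c j *: f j)).
  have [|j|al al0 hal] := @represents_sum r _ (index_enum _) q c x (fun j => link_ext (f j)).
  - exact: ar.
  - by have [_ _ H] := xP j; exact: (represents_le hD (ar _ (leqnn r0)) rr H).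
  by exists al => // t lt; rewrite -hal // link_ext_sum.
exists x; split=> [j|y [/gtorsionP[r1 yr1] dy]|c].
- by have [xt dx _] := xP j; split=> //; apply/gtorsionP; exists r0.
- pose r := maxn r0 r1; have rP := ar r (leq_maxl r0 r1).
  have yr : power_torsion i r y by exact: power_torsion_le (leq_maxr r0 r1) yr1.
  have [g gc yg] := represents_exists hD rP yr dy.
  have [h hZ hg] := set_cocycle_ext iL AE qm gc.
  have : h \in (U + B)%VS by rewrite addv_diff (addv_idPl BZ).
  case/memv_addP=> u uU [b bB hub].
  pose c j := coord (vbasis U) j u; exists c; apply/lc_coboundaryP; exists r.
  apply: (coboundary_represented hD rP (g := link_ext b)); last first.
    exact/(set_coboundary_link_ext iL AE b qm).
  have [al al0 hal] := representsZD hD (-1) (xr r (leq_maxl r0 r1) c) yg.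
  exists al.
    by apply: zigzag_eq al0 => // t _; rewrite scaleN1r addrC.
  move=> t lt; rewrite -hal // -hg // hub.
  have -> : \sum_j c j *: f j = u by rewrite [RHS](coord_vbasis uU).
  have := link_extZD 1 u b t; rewrite !scale1r => ->.
  by rewrite scaleN1r addKr.
move=> /lc_coboundaryP[r1 yr1]; pose r := maxn r0 r1.
have /(represents_coboundary hD (ar r (leq_maxl r0 r1))) := xr r (leq_maxl r0 r1) c.
move=> /(_ (power_coboundary_le (leq_maxr r0 r1) yr1)).
move=> /(set_coboundary_link_ext iL AE _ qm) sB.
(* The combination lies in [U] and is a coboundary, hence is zero. *)
have /freeP := basis_free (vbasisP U); apply; apply/eqP; rewrite -memv0 -(capv_diff Z B).
rewrite memv_cap -/B sB andbT; apply: memv_suml => j _; apply/memvZ/vbasis_mem/mem_nth.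
by rewrite size_tuple.
Qed.

Lemma lc_vanishes_inadmissible q : (forall t, level i q t -> ~~ admissible D a t) ->
  lc_vanishes I E q a.
Proof.
move=> nA; apply: lc_vanishes_set => g [g0 _]; case: q nA g0 => [|q] nA g0 /=.
  by move=> t lt; rewrite g0 ?nA.
by exists (fun=> 0) => // t lt; rewrite (negPf (nA t lt)).
Qed.

(* A vertex [j] with [0 < a j] is an apex of the admissible sets. *)
Lemma lc_vanishes_pos q j : j != i -> 0 < a j -> lc_vanishes I E q a.
Proof.
move=> ji aj; apply: lc_vanishes_set => g [g0 dg].
have Aj t : admissible D a (j |: t) = admissible D a t.
  rewrite /admissible; congr (_ && (_ \in D)); last first.
    by rewrite setUAC setUC; congr (_ :|: _); apply/setUidPr; rewrite sub1set inE.
  apply/subsetP/subsetP => H v va; last by rewrite inE H ?orbT.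
  have := H v va; rewrite !inE => /predU1P[vj|//].
  by move: va; rewrite inE vj ltNge (ltW aj).
have gE t : level i q t -> admissible D a t -> g t = cobound (cone_contraction j g) t.
  move=> lt At; apply: cone_contractionP => jt.
  by apply: dg; rewrite ?Aj //; exact: levelU1.
case: q g0 dg gE => [|q] g0 dg gE /=.
  move=> t lt; have [At|/(g0 t lt)//] := boolP (admissible D a t).
  by rewrite gE //; have /level0P-> := lt; rewrite /cobound big_set0.
exists (cone_contraction j g) => // t lt At; rewrite /cone_contraction.
case: ifPn => // jt; rewrite g0 ?scaler0 ?Aj //; exact: levelU1.
Qed.

Lemma lc_has_dim_redcoh (L : {set {set 'I_n}}) (s : {set 'I_n}) q :
    down_closed L -> (forall t, t \in L -> i \notin t) ->
    (forall t : {set 'I_n}, i \notin t -> admissible D a t = (s \subset t) && (t \in L)) ->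
  lc_has_dim I E q a
    (if s \in L then redcoh_dim k (link L s) (q%:Z - #|s|%:Z - 1) else 0%N).
Proof.
move=> hL iL AE; have [sL|sL] := boolP (s \in L); last first.
  apply/lc_has_dim0/lc_vanishes_inadmissible => t /andP[it _]; rewrite AE //.
  by apply: contra sL => /andP[st tL]; exact: hL tL.
have [sq|qs] := leqP #|s| q.
  have -> : q%:Z - #|s|%:Z - 1 = (q - #|s|)%N%:Z - 1 by rewrite subzn.
  rewrite /redcoh_dim subrK; apply: lc_has_dim_link => //.
  by rewrite subnKC.
(* For [q < #|s|] the cohomological degree is at most -2, where [redcoh_dim] is 0; on the other side
   an admissible set has at least [#|s|] elements, so none has [q]. *)
have -> : q%:Z - #|s|%:Z - 1 = Negz (#|s| - q.+1).+1.
  apply/eqP; rewrite NegzE -addrA -opprD -subr_eq0 opprK addrAC subr_eq0 -!PoszD eqz_nat.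
  by rewrite addn1 !addnS -addSn subnKC.
have -> : forall G m, redcoh_dim k G (Negz m.+1) = 0%N by move=> *; rewrite /redcoh_dim /=.
apply/lc_has_dim0/lc_vanishes_inadmissible => t /andP[it /eqP tq]; rewrite AE //.
by apply: contraL qs => /andP[/subset_leq_card st _]; rewrite -leqNgt -tq.
Qed.

End LocalCohomologyOfLink.

(** * Links in the deletion and in the link of a vertex, and the final case analysis *)

Lemma link_deletion n (D : {set {set 'I_n}}) i (s : {set 'I_n}) : down_closed D -> i \notin s ->
  link (deletion D i) s = link D s :&: deletion D i.
Proof.
move=> hD si; apply/setP => t; rewrite !inE negb_or si andbT.
have [tsD|] := boolP (t :|: s \in D); last by rewrite !andbF.
by rewrite (hD _ _ (subsetUl t s) tsD) andbT.
Qed.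

Lemma link_link n (D : {set {set 'I_n}}) i (s : {set 'I_n}) : i \notin s ->
  link (link D [set i]) s = link D (s :|: [set i]).
Proof.
move=> si; apply/setP => t; rewrite !inE setUA.
have -> : [disjoint t :|: s & [set i]] = [disjoint t & [set i]].
  by rewrite !disjoints_subset subUset -(disjoints_subset s) disjoint_sym disjoints1 si andbT.
by rewrite !disjoints_subset setCU subsetI andbA.
Qed.

Lemma down_closed_deletion n (D : {set {set 'I_n}}) i :
  down_closed D -> down_closed (deletion D i).
Proof.
move=> hD t u ut; rewrite !inE => /andP[tD it].
by rewrite (hD _ _ ut tD) (contra _ it) //; exact: (subsetP ut).
Qed.

Lemma mem_link1 n (D : {set {set 'I_n}}) i (t : {set 'I_n}) :
  (t \in link D [set i]) = (i \notin t) && (t :|: [set i] \in D).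
Proof. by rewrite inE disjoint_sym disjoints1. Qed.

Lemma supp_pos_eq0 n (i : 'I_n) (a : degree n) j : supp_pos i a = set0 -> 0 < a j -> j = i.
Proof.
move=> p0 aj; apply/eqP; apply: contraTT isT => ji.
by have := in_set0 j; rewrite -p0 inE ji aj.
Qed.

Theorem corollary2p10 (k : fieldType) (n : nat) (D : {set {set 'I_n}})
    (hD : simplicial_complex D) (i : 'I_n) (q : nat) (a : degree n)
    (E : ginjres (stanley_reisner_ring k D)) :
  let s := supp_neg i a in
  [/\ (supp_pos i a != set0 -> lc_vanishes (vertex_prime i) E q a),
      (supp_pos i a = set0 ->
         lc_has_dim (vertex_prime i) E q a
           (if (a i == 0) && (s \in deletion D i) then
              redcoh_dim k (link (deletion D i) s) (q%:Z - #|s|%:Z - 1)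
            else if (1 <= a i) && (s \in link D [set i]) then
              redcoh_dim k (link (link D [set i]) s) (q%:Z - #|s|%:Z - 1)
            else 0%N)),
      link (deletion D i) s = link D s :&: deletion D i
    & link (link D [set i]) s = link D (s :|: [set i])].
Proof.
move=> s; have {hD} hD : down_closed D by case: hD.
have si : i \notin s by rewrite inE eqxx.
split; [|move=> p0|exact: link_deletion|exact: link_link].
  by case/set0Pn => j; rewrite inE => /andP[ji aj]; exact: lc_vanishes_pos ji aj.
(* Admissibility refers to all coordinates, including [i], whereas [s] omits [i]; they agree unless
   [a i] is negative. *)
have sE : i \notin [set j | a j < 0] -> [set j | a j < 0] = s.
  move=> ia; apply/setP => j; rewrite !inE.
  by case: eqVneq => //= ->; apply/negbTE; rewrite inE in ia.
have [ai0|ai] := eqVneq (a i) 0.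
  have -> : (1 <= a i) = false by rewrite ai0.
  apply: lc_has_dim_redcoh => //; first exact: down_closed_deletion.
    by move=> t; rewrite inE => /andP[].
  move=> t it; rewrite /admissible sE ?inE ?ai0 // it andbT.
  rewrite (_ : [set j | 0 < a j] = set0) ?setU0 //.
  by apply/setP => j; rewrite !inE; apply/negP => aj; move: (aj); rewrite (supp_pos_eq0 p0 aj) ai0.
have [ai1|ai1] := leP 1 (a i).
  apply: lc_has_dim_redcoh => //; first exact: down_closed_link.
    by move=> t; rewrite mem_link1 => /andP[].
  (* Here the positive support of [a] is exactly {i}, so admissibility asks for [t :|: [set i]] in
     [D]. *)
  move=> t it; rewrite /admissible sE; last by rewrite inE -leNgt (le_trans _ ai1).
  rewrite mem_link1 it /=; congr (_ && (_ :|: _ \in D)).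
  apply/setP => j; rewrite !inE; apply/idP/eqP => [/(supp_pos_eq0 p0)//|->].
  exact: lt_le_trans ai1.
(* Now [a i < 0]: an admissible set would have to contain [i], which no level allows. *)
apply: lc_has_dim0; apply: (lc_vanishes_inadmissible hD) => t /andP[it _].
rewrite /admissible negb_and; apply/orP; left; apply: contra it => /subsetP -> //.
by rewrite inE lt_neqAle ai -ltzD1 add0r.
Qed.
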